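(* Let $A\in\mathbb{R}^{m\times m}$ be a normal matrix ($AA^*=A^*A$) such that $A+A^*$ has eigenvalues $0<\varphi_1\le\cdots\le\varphi_m$ with corresponding orthonormal eigenvectors $v_1,\ldots,v_m\in\mathbb{R}^m$, and let $\lambda_1,\ldots,\lambda_m$ be the eigenvalues of $A$ ordered ascendingly by real part, so that $\varphi_j=2\,\mathrm{Re}(\lambda_j)$. Let $\sigma\in\mathbb{R}^{m\times n}$ with $\sigma\sigma^*=I_m$ and let $L$ be a standard Brownian motion in $\mathbb{R}^n$. Let $X_t(x)$ be the solution of $\mathrm{d}X_t(x)=-AX_t(x)\,\mathrm{d}t+\sigma\,\mathrm{d}L_t$, $X_0(x)=x$, with invariant distribution $\mu$. Fix $x\in\mathbb{R}^m$, and for a time scale $(t_\varepsilon)_{\varepsilon>0}$ consider the cutoff stability property $$(\ast)\qquad\lim_{\varepsilon\to0}\frac{\mathcal{W}_2(X_{\delta\cdot t_\varepsilon}(x),\mu)}{\varepsilon}=\begin{cases}\infty&\text{for }\delta\in(0,1),\\0&\text{for }\delta>1.\end{cases}$$ (1) If $x\ne0$ with $\langle x,v_1\rangle\ne0$, then $(\ast)$ holds for $t_\varepsilon:=\frac{1}{\mathrm{Re}(\lambda_1)}|\ln(\varepsilon)|$. (2) If $x\ne0$ with $\langle x,v_1\rangle=0$ and $$\rho:=\min\{\mathrm{Re}(\lambda_j):j\in\{1,\ldots,m\},\ \langle x,v_j\rangle\ne0\}<2\,\mathrm{Re}(\lambda_1),$$ then $(\ast)$ holds for $t_\varepsilon:=\frac1\rho|\ln(\varepsilon)|$.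 (3) If $x=0$, then $(\ast)$ holds for $t_\varepsilon:=\frac{1}{2\,\mathrm{Re}(\lambda_1)}|\ln(\varepsilon)|$.
   Context: $\mathcal{W}_2(\mu_1,\mu_2)=\big(\inf_{\mathcal{T}}\int|u-v|^2\,\mathcal{T}(\mathrm{d}u,\mathrm{d}v)\big)^{1/2}$, where the infimum is over all couplings of $\mu_1$ and $\mu_2$; a random vector used as an argument stands for its law. $\langle\cdot,\cdot\rangle$ is the Euclidean inner product, $M^*$ the transpose, $I_m$ the identity. Here $\mu=\mathcal{N}(0,\Sigma_\infty)$ with $\Sigma_\infty=\int_0^\infty e^{-As}e^{-A^*s}\,\mathrm{d}s$. The limit is over $\varepsilon\downarrow0$. The case of a symmetric positive definite $A$ is included (with $v_j$ orthonormal eigenvectors of $A$). *)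

(* Defs.v *)
From HB Require Import structures.
From mathcomp Require Import all_boot all_order all_algebra.
From mathcomp Require Import complex.
From mathcomp Require Import all_classical all_reals all_analysis.

Set Implicit Arguments.
Unset Strict Implicit.
Unset Printing Implicit Defensive.

Import Order.TTheory GRing.Theory Num.Theory.
Import numFieldNormedType.Exports.

Local Open Scope classical_set_scope.
Local Open Scope ring_scope.

(* Column vectors carry the product sigma-algebra, generated by the coordinate
   maps (the library has it for tuples only); over R these are the Borel sets. *)
Definition measure_col_display : measure_display -> measure_display.
Proof. exact. Qed.

Section measurable_col.
Context {d} {T : sigmaRingType d}.
Variable n : nat.

Let coors : 'I_n -> 'cV[T]_n -> T := fun i x => x i ord0.

Let col_set0 : g_sigma_preimage coors set0.
Proof. exact: sigma_algebra0. Qed.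

Let col_setC A : g_sigma_preimage coors A -> g_sigma_preimage coors (~` A).
Proof. exact: sigma_algebraC. Qed.

Let col_bigcup (F : _^nat) : (forall i, g_sigma_preimage coors (F i)) ->
  g_sigma_preimage coors (\bigcup_i (F i)).
Proof. exact: sigma_algebra_bigcup. Qed.

HB.instance Definition _ := @isMeasurable.Build (measure_col_display d)
  'cV[T]_n (g_sigma_preimage coors) col_set0 col_setC col_bigcup.

End measurable_col.

Section linear_algebra.
Context {R : realType}.

Definition inner (n : nat) (x y : 'cV[R]_n) : R := \sum_(i < n) x i 0 * y i 0.

Definition sqnorm (n : nat) (x : 'cV[R]_n) : R := inner x x.

Definition orthonormal_family (m n : nat) (v : 'I_m -> 'cV[R]_n) : Prop :=
  forall i j, inner (v i) (v j) = (i == j)%:R.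

(* lambda lists the complex eigenvalues of A with algebraic multiplicity. *)
Definition eigenvalues_of (n : nat) (A : 'M[R]_n) (lambda : 'I_n -> R[i]) :
    Prop :=
  char_poly (map_mx (fun a : R => (a%:C)%C) A) =
  \prod_(j < n) ('X - (lambda j)%:P).

Definition expmx (n : nat) (M : 'M[R]_n) : 'M[R]_n :=
  limn (series (fun k => (k`!%:R)^-1 *: M ^+ k)).

Definition Sigma_infty (n : nat) (A : 'M[R]_n) : 'M[R]_n :=
  \matrix_(i, j) \int[@lebesgue_measure R]_(s in `[0, +oo[)
    (expmx (- s *: A) *m expmx (- s *: A^T)) i j.

End linear_algebra.

Section gaussian.
Context {R : realType}.

Definition standard_gaussian (n : nat) (N : probability 'cV[R]_n R) : Prop :=
  forall B : 'I_n -> set R, (forall i, measurable (B i)) ->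
    N [set z : 'cV[R]_n | forall i, B i (z i ord0)] =
    (\prod_(i < n) normal_prob 0 1 (B i))%E.

(* Q is N(a, Sigma): the law of a + S Z with Z standard Gaussian and
   S S^* = Sigma (Sigma may be singular). It does not depend on the choice of S.
   Q is a plain set function so that the laws of differences of random vectors
   can be written as pushforwards. *)
Definition gaussian_law (n : nat) (a : 'cV[R]_n) (Sigma : 'M[R]_n)
    (Q : set 'cV[R]_n -> \bar R) : Prop :=
  exists (S : 'M[R]_n) (N : probability 'cV[R]_n R),
    [/\ S *m S^T = Sigma,
        standard_gaussian N &
        forall B : set 'cV[R]_n, measurable B ->
          Q B = pushforward N (fun z => a + S *m z) B].

End gaussian.

Section processes.
Context {R : realType} {d : measure_display} {Omega : measurableType d}.
Variable P : probability Omega R.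

(* Taking some B i to be the full set gives the product rule for every
   subfamily. *)
Definition mutually_independent (I : finType) d' (T : measurableType d')
    (X : I -> Omega -> T) : Prop :=
  forall B : I -> set T, (forall i, measurable (B i)) ->
    P [set w | forall i, B i (X i w)] =
    (\prod_(i : I) P [set w | B i (X i w)])%E.

(* Time is R, but only the restrictions of processes to [0, +oo[ matter. *)
Definition standard_brownian_motion (n : nat) (L : R -> {RV P >-> 'cV[R]_n}) :
    Prop :=
  [/\ {ae P, forall w, L 0 w = 0},
      {ae P, forall w, {within `[0, +oo[, continuous (fun t => L t w)}},
      (forall (k : nat) (t : nat -> R), 0 <= t 0%N ->
         (forall j, (j < k)%N -> t j < t j.+1) ->
         mutually_independent
           (fun (j : 'I_k) w => L (t j.+1) w - L (t j) w)) &
      (forall s t : R, 0 <= s -> s < t ->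
         gaussian_law 0 ((t - s)%:M) (pushforward P (fun w => L t w - L s w)))].

(* X solves dX_t = - A X_t dt + sigma dL_t, X_0 = x. The noise being additive,
   the integral equation is pathwise. *)
Definition sde_solution (m n : nat) (A : 'M[R]_m) (sigma : 'M[R]_(m, n))
    (L : R -> {RV P >-> 'cV[R]_n}) (x : 'cV[R]_m)
    (X : R -> {RV P >-> 'cV[R]_m}) : Prop :=
  {ae P, forall w,
    {within `[0, +oo[, continuous (fun t => X t w)} /\
    forall t, 0 <= t ->
      X t w = x
        + \col_i (\int[@lebesgue_measure R]_(s in `[0, t])
                    (- (A *m X s w)) i 0)
        + sigma *m L t w}.

End processes.

Section wasserstein.
Context {R : realType} {n : nat}.

Definition is_coupling (mu1 mu2 : probability 'cV[R]_n R)
    (T : probability ('cV[R]_n * 'cV[R]_n)%type R) : Prop :=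
  forall B : set 'cV[R]_n, measurable B ->
    T (B `*` setT) = mu1 B /\ T (setT `*` B) = mu2 B.

Definition wasserstein2 (mu1 mu2 : probability 'cV[R]_n R) : \bar R :=
  sqrte (ereal_inf [set (\int[T]_z (sqnorm (z.1 - z.2))%:E)%E
    | T in is_coupling mu1 mu2]).

End wasserstein.

Definition cutoff_stability {R : realType} {d : measure_display}
    {Omega : measurableType d} (P : probability Omega R) (n : nat)
    (X : R -> {RV P >-> 'cV[R]_n}) (mu : probability 'cV[R]_n R)
    (tscale : R -> R) : Prop :=
  let ratio (delta eps : R) : \bar R :=
    (wasserstein2 (distribution P (X (delta * tscale eps)%R)) mu
       * (eps^-1)%:E)%E in
  (forall delta, 0 < delta < 1 -> ratio delta eps @[eps --> 0^'+] --> +oo%E) /\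
  (forall delta, 1 < delta -> ratio delta eps @[eps --> 0^'+] --> 0%E).

(* Main.v *)
(** All laws involved are identified through characteristic functions. Variation
    of constants and a Riemann-sum argument show that [X_t] is the image of [mu]
    under [y |-> a + K y], where [a = e^{-tA} x] and [K] is diagonal in the basis
    [v] with entries [sqrt (1 - e^{- phi_l t})]. Normality of [A] gives
    [|a|^2 = sum_l e^{- phi_l t} <v_l, x>^2]. The coupling [(a + K y, y)] bounds
    the Wasserstein distance from above by a multiple of [|a| + e^{- phi_1 t}];
    Kantorovich duality with affine and quadratic potentials bounds it from below
    by [|a|], and by a multiple of [e^{- phi_1 t}] when [x = 0]. In each of the
    three cases the distance is thus squeezed between multiples of one
    exponential [e^{- r t}], and cutoff occurs at [r^-1 |ln eps|]. *)
Require Import Defs.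
From HB Require Import structures.
From mathcomp Require Import all_boot all_order all_algebra.
From mathcomp Require Import complex spectral.
From mathcomp Require Import all_classical all_reals all_analysis.
From mathcomp Require Import measurable_realfun ring lra.

Set Implicit Arguments.
Unset Strict Implicit.
Unset Printing Implicit Defensive.

Import Order.TTheory GRing.Theory Num.Theory.
Import numFieldNormedType.Exports.

Local Open Scope classical_set_scope.
Local Open Scope ring_scope.

(** Mean and covariance relax at different rates: along [v l] the mean decays like e^{- Re(lambda_l)
    t}, whereas the covariance error decays like e^{- phi_l t}, twice as fast because phi_l = 2
    Re(lambda_l). In (1) and (2) the slowest mode present in x is slower than e^{- phi_1 t}; in (2)
    this is what rho < 2 Re(lambda_1) grants. The mean then decides. For x = 0 only the covariance
    is left, and the rate doubles. No stochastic integral is built. The noise is additive, so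
    weighted sums of Brownian increments converge along almost every path by ordinary calculus, and
    probability enters only through the law of a finite sum of independent Gaussians. Representing
    X_t as an image of mu has a further benefit: the cost in the upper bound and the potentials in
    the lower bound all become integrals against mu, of which only the mean, finiteness of second
    moments and positivity of one of them are used. *)

Lemma measurable_cos (R : realType) : measurable_fun setT (@cos R).
Proof. by apply: continuous_measurable_fun; exact: continuous_cos. Qed.

Lemma measurable_sin (R : realType) : measurable_fun setT (@sin R).
Proof. by apply: continuous_measurable_fun; exact: continuous_sin. Qed.

Lemma bounded_integrable (R : realType) d (T : measurableType d)
    (P : probability T R) (f : T -> R) (M : R) :
  measurable_fun setT f -> (forall x, `|f x| <= M) ->
  P.-integrable setT (EFin \o f).
Proof.
move=> mf fM; apply: measurable_bounded_integrable => //.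
  exact: le_lt_trans (probability_le1 P measurableT) (ltry _).
exists M; split; first exact: num_real.
by move=> y My x _; apply: le_trans (fM x) (ltW My).
Qed.

Lemma bounded_cvg_Rintegral (R : realType) d (T : measurableType d)
    (P : probability T R) (f_ : nat -> T -> R) (f : T -> R) (M : R) :
  (forall k, measurable_fun setT (f_ k)) -> measurable_fun setT f ->
  (forall k x, `|f_ k x| <= M) ->
  {ae P, forall x, f_ k x @[k --> \oo] --> f x} ->
  (\int[P]_x f_ k x) @[k --> \oo] --> \int[P]_x f x.
Proof.
move=> mf_ mf f_M cf.
have := @dominated_convergence _ _ _ P setT measurableT
  (fun k x => (f_ k x)%:E) (EFin \o f) (fun=> M%:E).
case.
- by move=> k; apply/measurable_EFinP.
- by apply/measurable_EFinP.
- case: cf => N [mN N0 subN]; exists N; split => // x /= nx; apply: subN => /= cx.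
  by apply: nx => _; exact: cvg_EFin (nearW _ _) cx.
- apply: (@bounded_integrable _ _ _ P (fun=> M) `|M|) => //.
- by apply/aeW => x n _ /=; rewrite lee_fin.
move=> fi _ c3.
apply: fine_cvg.
rewrite fineK //.
exact: integrable_fin_num.
Qed.

(** * Measurability of column vectors *)

Section measurable_column.
Context {R : realType} {n : nat}.

Lemma measurable_coord (i : 'I_n) :
  measurable_fun setT (fun x : 'cV[R]_n => x i ord0).
Proof.
move=> _ Y mY; rewrite setTI; apply: sub_sigma_algebra => /=.
rewrite -bigcup_seq/=; exists i => /=; first by rewrite mem_index_enum.
by exists Y => //; rewrite setTI.
Qed.

Lemma measurable_fun_col d (T : measurableType d) (f : T -> 'cV[R]_n) :
  (forall i, measurable_fun setT (fun w => f w i ord0)) ->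
  measurable_fun setT f.
Proof.
move=> mf; apply: (@measurability _ _ T 'cV[R]_n setT f _ (erefl _)) => _ [C CB <-].
move: CB; rewrite -bigcup_seq => -[i /= _ [B mB <-]].
rewrite !setTI -comp_preimage -[X in measurable X]setTI.
exact: mf.
Qed.

Lemma measurable_inner (u : 'cV[R]_n) : measurable_fun setT (inner u).
Proof.
apply: measurable_sum => i; apply: measurable_funM; first exact: measurable_cst.
exact: measurable_coord.
Qed.

End measurable_column.

(** * Uniqueness of characteristic functions *)

Section trigonometric_polynomials.
Context {R : realType} {n : nat}.

Lemma inner0l (x : 'cV[R]_n) : inner 0 x = 0.
Proof. by apply: big1 => i _; rewrite mxE mul0r. Qed.

Lemma innerDl (u v x : 'cV[R]_n) : inner (u + v) x = inner u x + inner v x.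
Proof. by rewrite -big_split; apply: eq_bigr => i _; rewrite mxE mulrDl. Qed.

Lemma innerZl a (u x : 'cV[R]_n) : inner (a *: u) x = a * inner u x.
Proof. by rewrite mulr_sumr; apply: eq_bigr => i _; rewrite mxE mulrA. Qed.

Lemma innerNl (u x : 'cV[R]_n) : inner (- u) x = - inner u x.
Proof. by rewrite -scaleN1r innerZl mulN1r. Qed.

Lemma inner_delta i (x : 'cV[R]_n) : inner (delta_mx i 0) x = x i 0.
Proof.
rewrite /inner (bigD1 i)//= mxE !eqxx mul1r big1 ?addr0// => j ji.
by rewrite mxE (negbTE ji) mul0r.
Qed.

(** Cosines with a phase have a span closed under products, by the product-to-sum formula. Hence two
    measures with the same characteristic function integrate alike every polynomial in sines and
    cosines of linear forms. *)
Inductive trigpoly : ('cV[R]_n -> R) -> Prop :=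
| trigpoly_cos a u b : trigpoly (fun x => a * cos (inner u x + b))
| trigpolyD f g : trigpoly f -> trigpoly g -> trigpoly (fun x => f x + g x).

Lemma eq_trigpoly f g : trigpoly f -> f =1 g -> trigpoly g.
Proof. by move=> + /funext <-. Qed.

Lemma trigpoly_cst a : trigpoly (fun=> a).
Proof.
apply: (eq_trigpoly (trigpoly_cos a 0 0)) => x.
by rewrite inner0l addr0 cos0 mulr1.
Qed.

Lemma trigpoly_sin u b : trigpoly (fun x => sin (inner u x + b)).
Proof.
apply: (eq_trigpoly (trigpoly_cos 1 u (b - pi / 2))) => x.
by rewrite mul1r addrA cosBpihalf.
Qed.

Lemma trigpolyM f g : trigpoly f -> trigpoly g -> trigpoly (fun x => f x * g x).
Proof.
move=> tf tg; elim: tf => [a u b|f1 f2 _ IH1 _ IH2]; last first.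
  by apply: (eq_trigpoly (trigpolyD IH1 IH2)) => x; rewrite mulrDl.
elim: tg => [c v e|g1 g2 _ IH1 _ IH2]; last first.
  by apply: (eq_trigpoly (trigpolyD IH1 IH2)) => x; rewrite mulrDr.
apply: (eq_trigpoly (trigpolyD (trigpoly_cos (a * c / 2) (u + v) (b + e))
  (trigpoly_cos (a * c / 2) (u - v) (b - e)))) => x.
rewrite !innerDl innerNl.
rewrite (_ : inner u x + inner v x + (b + e) =
  (inner u x + b) + (inner v x + e)); last by ring.
rewrite (_ : inner u x - inner v x + (b - e) =
  (inner u x + b) + - (inner v x + e)); last by ring.
move: (inner u x + b) (inner v x + e) => y z.
by rewrite !cosD cosN sinN; field.
Qed.

Lemma trigpolyX f k : trigpoly f -> trigpoly (fun x => f x ^+ k).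
Proof.
move=> tf; elim: k => [|k IH]; first exact: trigpoly_cst.
by apply: (eq_trigpoly (trigpolyM tf IH)) => x; rewrite exprS.
Qed.

Lemma trigpoly_prod (I : Type) (s : seq I) (F : I -> 'cV[R]_n -> R) :
  (forall i, trigpoly (F i)) -> trigpoly (fun x => \prod_(i <- s) F i x).
Proof.
move=> tF; elim: s => [|i s IH].
  by apply: (eq_trigpoly (trigpoly_cst 1)) => x; rewrite big_nil.
by apply: (eq_trigpoly (trigpolyM (tF i) IH)) => x; rewrite big_cons.
Qed.

Lemma measurable_cos_inner (u : 'cV[R]_n) b :
  measurable_fun setT (fun x => cos (inner u x + b)).
Proof.
apply: measurableT_comp; first exact: measurable_cos.
by apply: measurable_funD => //; exact: measurable_inner.
Qed.

Lemma trigpoly_measurable f : trigpoly f -> measurable_fun setT f.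
Proof.
elim=> [a u b|g h _ mg _ mh]; last exact: measurable_funD.
by apply: measurable_funM => //; exact: measurable_cos_inner.
Qed.

Lemma trigpoly_integrable (P : probability 'cV[R]_n R) f :
  trigpoly f -> P.-integrable setT (EFin \o f).
Proof.
elim=> [a u b|g h _ mg _ mh].
  apply: (@bounded_integrable _ _ _ P _ `|a|).
    by apply: measurable_funM => //; exact: measurable_cos_inner.
  by move=> x; rewrite normrM ler_piMr// cos_max.
by apply: eq_integrable (integrableD measurableT mg mh).
Qed.

Lemma trigpoly_eq_Rintegral (P Q : probability 'cV[R]_n R) f :
  (forall u b, \int[P]_x cos (inner u x + b) = \int[Q]_x cos (inner u x + b)) ->
  trigpoly f -> \int[P]_x f x = \int[Q]_x f x.
Proof.
move=> PQ; elim=> [a u b|g h tg IHg th IHh].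
  rewrite !RintegralZl// ?PQ//;
  apply: (@bounded_integrable _ _ _ _ _ 1);
    by [exact: measurable_cos_inner|move=> x; rewrite cos_max].
by rewrite !RintegralD ?IHg ?IHh//; exact: trigpoly_integrable.
Qed.

End trigonometric_polynomials.

Section threshold.
Context {R : realType}.

(* On [0, 1] these polynomials converge to the indicator of [0, 1/2[; the factor
   k in the exponent forces the limit 0 at y = 1/2. *)
Definition soft_threshold (k : nat) (y : R) : R := (1 - y ^+ k) ^+ (k * 2 ^ k).

Lemma soft_threshold_bounds k (y : R) : 0 <= y <= 1 ->
  0 <= soft_threshold k y <= 1.
Proof.
move=> /andP[y0 y1]; rewrite exprn_ge0 ?exprn_ile1 ?subr_ge0 ?exprn_ile1//.
by rewrite lerBlDr lerDl exprn_ge0.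
Qed.

Lemma bernoulli_ineq (a : R) k : -1 <= a -> 1 + k%:R * a <= (1 + a) ^+ k.
Proof.
move=> a1; elim: k => [|k IH]; first by rewrite mul0r addr0 expr0.
rewrite exprS; apply: (@le_trans _ _ ((1 + a) * (1 + k%:R * a))).
  have : 0 <= k%:R * a ^+ 2 :> R by rewrite mulr_ge0 ?sqr_ge0.
  rewrite -natr1; nra.
by rewrite ler_wpM2l//; lra.
Qed.

(** Split z^k as w^k w^k with w = sqrt z. By Bernoulli, w^-k >= k h with h = w^-1 - 1, so one factor
    w^k absorbs k and the other tends to 0. *)
Lemma cvg_nat_expr (z : R) : 0 <= z < 1 -> k%:R * z ^+ k @[k --> \oo] --> (0 : R).
Proof.
move=> /andP[z0 z1]; have [->|zn0] := eqVneq z 0.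
  apply: (@cvg_trans _ ((fun=> 0 : R) @ \oo)); last exact: cvg_cst.
  apply: near_eq_cvg; near=> k.
  rewrite expr0n gtn_eqF ?mulr0//; near: k; exact: nbhs_infty_gt.
pose w := Num.sqrt z; have z_gt0 : 0 < z by rewrite lt0r zn0.
have w0 : 0 < w by rewrite sqrtr_gt0.
have w1 : w < 1 by rewrite -sqrtr1 ltr_sqrt.
have wz : z = w * w by rewrite -expr2 sqr_sqrtr.
pose h := w^-1 - 1.
have h0 : 0 < h by rewrite subr_gt0 invf_gt1.
apply: (@squeeze_cvgr _ _ _ _ (cst 0) (fun k => h^-1 * w ^+ k)).
- near=> k; rewrite mulr_ge0 ?exprn_ge0//= wz exprMn mulrA.
  rewrite ler_wpM2r ?exprn_ge0 ?(ltW w0)//.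
  have : 1 + k%:R * h <= (1 + h) ^+ k by apply: bernoulli_ineq; lra.
  have -> : 1 + h = w^-1 by rewrite /h; lra.
  rewrite exprVn => kh.
  have wk : 0 < w ^+ k by rewrite exprn_gt0.
  rewrite -[leRHS]mul1r ler_pdivlMr// mulrAC -ler_pdivlMr// div1r.
  by apply: le_trans kh; rewrite lerDr.
- exact: cvg_cst.
- rewrite -[X in _ --> X](mulr0 h^-1); apply: cvgMl_tmp => //.
  by apply: cvg_expr; rewrite gtr0_norm.
Unshelve. all: by end_near. Qed.

(** Bernoulli serves on both sides. For y < 1/2 the value is at least 1 - k (2 y)^k. For y >= 1/2,
    its product with (1 + y^k)^(k 2^k) is at most 1, and that factor is at least 1 + k (2 y)^k >= k
    + 1. *)
Lemma cvg_soft_threshold (y : R) : 0 <= y <= 1 ->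
  soft_threshold k y @[k --> \oo] --> ((y < 2^-1)%R%:R : R).
Proof.
move=> /andP[y0 y1]; have [ylt|yge] := ltP y (2^-1) => /=.
  apply: (@squeeze_cvgr _ _ _ _ (fun k => 1 - k%:R * (2 * y) ^+ k) (cst 1)).
  - near=> k; apply/andP; split; last first.
      by have /andP[] : 0 <= soft_threshold k y <= 1 by rewrite soft_threshold_bounds ?y0.
    apply: le_trans (@bernoulli_ineq (- y ^+ k) (k * 2 ^ k) _).
      by rewrite natrM natrX exprMn mulrN -mulrA.
    by rewrite lerN2 exprn_ile1.
  - rewrite -[X in _ --> X]subr0; apply: cvgB; first exact: cvg_cst.
    by apply: cvg_nat_expr; apply/andP; split; lra.
  - exact: cvg_cst.
apply: (@squeeze_cvgr _ _ _ _ (cst 0) (fun k => (k.+1%:R)^-1)); last 2 first.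
- exact: cvg_cst.
- exact: cvg_harmonic.
near=> k.
have /andP[-> _] /= : 0 <= soft_threshold k y <= 1.
  by rewrite soft_threshold_bounds ?y0.
have yk0 : 0 <= y ^+ k by rewrite exprn_ge0.
have yk1 : y ^+ k <= 1 by rewrite exprn_ile1.
rewrite -[leRHS]mul1r ler_pdivlMr ?ltr0n//.
apply: (@le_trans _ _ (soft_threshold k y * (1 + y ^+ k) ^+ (k * 2 ^ k))).
  apply: ler_wpM2l; first by apply: exprn_ge0; rewrite subr_ge0.
  apply: le_trans (@bernoulli_ineq (y ^+ k) (k * 2 ^ k) _); last by lra.
  rewrite natrM natrX -mulrA -exprMn -natr1 addrC lerD2l ler_peMr//.
  by rewrite exprn_ege1//; lra.
rewrite /soft_threshold -exprMn exprn_ile1//; nra.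
Unshelve. all: by end_near. Qed.

End threshold.

Section characteristic_function_uniqueness.
Context {R : realType} {n : nat}.

Lemma cvg_prod_seq (I : Type) (s : seq I) (F : nat -> I -> R) (l : I -> R) :
  (forall i, F k i @[k --> \oo] --> l i) ->
  \prod_(i <- s) F k i @[k --> \oo] --> \prod_(i <- s) l i.
Proof.
move=> Fl; elim: s => [|i s IH].
  under eq_fun do rewrite big_nil.
  by rewrite big_nil; exact: cvg_cst.
under eq_fun do rewrite big_cons.
by rewrite big_cons; apply: cvgM.
Qed.

Lemma prod_bounds (I : Type) (s : seq I) (F : I -> R) :
  (forall i, 0 <= F i <= 1) -> `|\prod_(i <- s) F i| <= 1.
Proof.
move=> F01; suff /andP[h0 h1] : 0 <= \prod_(i <- s) F i <= 1 by rewrite ger0_norm.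
elim: s => [|i s /andP[s0 s1]]; first by rewrite big_nil lexx ler01.
have /andP[i0 i1] := F01 i.
by rewrite big_cons mulr_ge0// mulr_ile1.
Qed.

(** Measurability of the limit is part of the conclusion because limits are taken twice in
    succession: the first limit functions are the approximants of the second step. *)
Lemma bounded_cvg_eq_Rintegral d (T : measurableType d) (P Q : probability T R)
    (f_ : nat -> T -> R) (f : T -> R) :
  (forall k, measurable_fun setT (f_ k)) ->
  (forall k x, `|f_ k x| <= 1) ->
  (forall x, f_ k x @[k --> \oo] --> f x) ->
  (forall k, \int[P]_x f_ k x = \int[Q]_x f_ k x) ->
  measurable_fun setT f /\ \int[P]_x f x = \int[Q]_x f x.
Proof.
move=> mf_ f1 cf PQ.
have mf : measurable_fun setT f.
  by apply: (measurable_fun_cvg mf_) => x _; exact: cf.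
split=> //.
have cP := bounded_cvg_Rintegral (P := P) mf_ mf f1 (aeW _ cf).
have cQ := bounded_cvg_Rintegral (P := Q) mf_ mf f1 (aeW _ cf).
rewrite -(cvg_lim (@Rhausdorff R) cP) -(cvg_lim (@Rhausdorff R) cQ).
by congr (lim (_ @ \oo)); apply/funext.
Qed.

(* For r large, sine_coord c r i x < 1/2 holds exactly when c i < x i 0. *)
Definition sine_coord (c : 'I_n -> R) (r : nat) (i : 'I_n) (x : 'cV[R]_n) : R :=
  (1 - sin ((x i 0 - c i) / r.+1%:R)) / 2.

Lemma sine_coord_bounds c r i x : 0 <= sine_coord c r i x <= 1.
Proof.
rewrite /sine_coord; set t := _ / r.+1%:R.
have := sin_le1 t; have := sin_geN1 t.
by move=> h1 h2; apply/andP; split; lra.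
Qed.

Lemma trigpoly_soft_threshold c r k :
  trigpoly (fun x => \prod_(i < n) soft_threshold k (sine_coord c r i x)).
Proof.
apply: trigpoly_prod => i; apply: trigpolyX.
have tY : trigpoly (sine_coord c r i).
  apply: (eq_trigpoly (trigpolyD (trigpoly_cst (2^-1))
    (trigpolyM (trigpoly_cst (- 2^-1))
       (trigpoly_sin (r.+1%:R^-1 *: delta_mx i 0) (- c i / r.+1%:R))))) => x.
  rewrite innerZl inner_delta /sine_coord mulrBl mulrC.
  have -> : (x i 0 - c i) / r.+1%:R = r.+1%:R^-1 * x i 0 + - c i / r.+1%:R by ring.
  by field.
apply: (eq_trigpoly (trigpolyD (trigpoly_cst 1)
  (trigpolyM (trigpoly_cst (-1)) (trigpolyX k tY)))) => x.
by rewrite mulN1r.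
Qed.

(** Once r is large the angle lies in ]-pi, pi[, where the sine has the sign of its argument; the
    sequence is then constant. *)
Lemma cvg_sine_coord c i x :
  (sine_coord c r i x < 2^-1)%R%:R @[r --> \oo] --> ((c i < x i 0)%R%:R : R).
Proof.
apply: (@cvg_trans _ ((fun=> (c i < x i 0)%R%:R : R) @ \oo)); last exact: cvg_cst.
apply: near_eq_cvg; near=> r; congr (nat_of_bool _)%:R.
pose t := (x i 0 - c i) / r.+1%:R.
have r0 : 0 < r.+1%:R :> R by rewrite ltr0n.
have : `|t| < pi.
  rewrite normrM normfV (gtr0_norm r0) ltr_pdivrMr//.
  rewrite mulrC -ltr_pdivrMr ?pi_gt0//.
  rewrite (lt_le_trans (truncnS_gt _))// ler_nat ltnS.
  near: r; exact: nbhs_infty_ge.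
rewrite ltr_norml => /andP[t1 t2].
rewrite /sine_coord -/t.
have [cx|xc|cx] := ltgtP (c i) (x i 0).
- have t0 : 0 < t by rewrite divr_gt0 ?subr_gt0.
  have := @sin_gt0_pi _ t; rewrite t0 t2 => /(_ isT) st.
  by apply/esym; lra.
- have t0 : 0 < - t by rewrite -mulNr divr_gt0 ?opprB ?subr_gt0.
  have := @sin_gt0_pi _ (- t); rewrite t0 ltrNl t1 => /(_ isT).
  by rewrite sinN => st; apply/esym/negbTE; rewrite -leNgt; lra.
- have -> : t = 0 by rewrite /t cx subrr mul0r.
  by rewrite sin0; apply/esym/negbTE; rewrite -leNgt; lra.
Unshelve. all: by end_near. Qed.

Definition orthant (c : 'I_n -> R) : set 'cV[R]_n :=
  [set x | forall i, c i < x i 0].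

Lemma measurable_orthant c : measurable (orthant c).
Proof.
have -> : orthant c = \big[setI/setT]_(i < n) [set x : 'cV[R]_n | c i < x i 0].
  apply/seteqP; split=> x /=; first by move=> h; rewrite -bigcap_seq => i _ /=.
  by rewrite -bigcap_seq => h i; apply: h => /=; rewrite mem_index_enum.
apply: bigsetI_measurable => i _.
rewrite -[X in measurable X]setTI.
have -> : [set x : 'cV[R]_n | c i < x i 0] =
   (fun x : 'cV[R]_n => x i 0) @^-1` `]c i, +oo[%classic.
  by apply/seteqP; split=> x /=; rewrite in_itv/= andbT.
exact: measurable_coord.
Qed.

Lemma Rintegral_orthant (P : probability 'cV[R]_n R) c :
  \int[P]_x \prod_(i < n) (c i < x i 0)%R%:R = fine (P (orthant c)).
Proof.
rewrite /Rintegral; congr fine.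
rewrite -[in RHS](setIT (orthant c)) -integral_indic//; last exact: measurable_orthant.
apply: eq_integral => x _; rewrite indicE; congr EFin.
have [xc|xc] := boolP (x \in orthant c).
  by apply: big1 => i _; move: xc; rewrite inE => /(_ i) ->.
have /existsP[i ic] : [exists i, ~~ (c i < x i 0)].
  rewrite -negb_forall; apply: contra xc => /forallP h; rewrite inE => i; exact: h.
by rewrite (bigD1 i)//= (negbTE ic) mul0r.
Qed.

(** Two limits in succession: at fixed r, the limit in k sharpens the threshold to an indicator; the
    limit in r then removes the periodicity of the sine. *)
Lemma charfun_orthant (P Q : probability 'cV[R]_n R) c :
  (forall u b, \int[P]_x cos (inner u x + b) = \int[Q]_x cos (inner u x + b)) ->
  P (orthant c) = Q (orthant c).
Proof.
move=> PQ.
have step1 r : measurable_fun setT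
    (fun x => \prod_(i < n) ((sine_coord c r i x < 2^-1)%R%:R : R)) /\
    \int[P]_x \prod_(i < n) (sine_coord c r i x < 2^-1)%R%:R =
    \int[Q]_x \prod_(i < n) (sine_coord c r i x < 2^-1)%R%:R.
  apply: (@bounded_cvg_eq_Rintegral _ _ P Q
    (fun k x => \prod_(i < n) soft_threshold k (sine_coord c r i x))).
  - by move=> k; exact: trigpoly_measurable (trigpoly_soft_threshold c r k).
  - by move=> k x; apply: prod_bounds => i;
      exact: soft_threshold_bounds (sine_coord_bounds c r i x).
  - by move=> x; apply: cvg_prod_seq => i;
      exact: cvg_soft_threshold (sine_coord_bounds c r i x).
  - by move=> k; exact: trigpoly_eq_Rintegral (trigpoly_soft_threshold c r k).
have [_] : measurable_fun setT (fun x : 'cV[R]_n => \prod_(i < n) ((c i < x i 0)%R%:R : R)) /\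
    \int[P]_x \prod_(i < n) (c i < x i 0)%R%:R =
    \int[Q]_x \prod_(i < n) (c i < x i 0)%R%:R.
  apply: (@bounded_cvg_eq_Rintegral _ _ P Q
    (fun r x => \prod_(i < n) (sine_coord c r i x < 2^-1)%R%:R)).
  - by move=> r; exact: (step1 r).1.
  - by move=> r x; apply: prod_bounds => i; case: (_ < _)%R; rewrite ?lexx ?ler01.
  - by move=> x; apply: cvg_prod_seq => i; exact: cvg_sine_coord.
  - by move=> r; exact: (step1 r).2.
rewrite !Rintegral_orthant => PQc.
have mc := measurable_orthant c.
by rewrite -[LHS]fineK ?fin_num_measure// PQc fineK// fin_num_measure.
Qed.

Lemma coord_lower_bound (x : 'cV[R]_n) :
  exists k : nat, forall j, - k%:R < x j 0.
Proof.
pose F (j : 'I_n) := (Num.truncn `|x j 0|).+1.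
exists (\max_(j < n) F j) => j.
rewrite ltrNl (le_lt_trans (ler_norm _))// normrN.
apply: lt_le_trans (truncnS_gt _) _; rewrite ler_nat.
exact: (leq_bigmax (F := F)).
Qed.

(** A half-space bounding one coordinate is the countable union of the orthants whose other bounds
    are - k. *)
Lemma measurable_col_orthant :
  measurable `<=` <<s [set orthant c | c in [set: 'I_n -> R]] >>.
Proof.
apply: smallest_sub; first exact: smallest_sigma_algebra.
rewrite -bigcup_seq => _ [i _ [B mB <-]].
set G := [set orthant c | c in _].
have := @measurability _ _ (g_sigma_algebraType G) R setT
  (fun x : 'cV[R]_n => x i 0) _ (RGenOInfty.measurableE R).
rewrite setTI => mi; rewrite -[X in _ X]setTI; apply: mi => //.
move=> _ [_ [a ->] <-]; rewrite setTI.
have -> : (fun x : 'cV[R]_n => x i 0) @^-1` `]a, +oo[%classic =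
    \bigcup_k orthant (fun j => if j == i then a else - k%:R).
  apply/seteqP; split=> x /=; rewrite in_itv/= andbT; last first.
    by case=> k _ /(_ i); rewrite eqxx.
  move=> ax; have [k kx] := coord_lower_bound x.
  by exists k => // j; case: eqVneq => [->|_].
by apply: bigcup_measurable => k _; apply: sub_sigma_algebra; eexists.
Qed.

(* The phase b replaces complex exponentials: b = 0 and b = - pi / 2 give the
   real and the imaginary part of the characteristic function. *)
Theorem charfun_unique (P Q : probability 'cV[R]_n R) :
  (forall u b, \int[P]_x cos (inner u x + b) = \int[Q]_x cos (inner u x + b)) ->
  forall A, measurable A -> P A = Q A.
Proof.
move=> PQ A /measurable_col_orthant mA.
apply: (@g_sigma_algebra_measure_unique _ R _
   [set orthant c | c in [set: 'I_n -> R]] _ (fun k => orthant (fun=> - k%:R))) mA.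
- by move=> _ [c _ <-]; exact: measurable_orthant.
- by move=> k; eexists.
- apply/seteqP; split=> // x _.
  by have [k kx] := coord_lower_bound x; exists k.
- move=> _ _ [c _ <-] [e _ <-]; exists (fun i => Num.max (c i) (e i)) => //.
  apply/seteqP; split=> x /=.
    by move=> h; split=> i; have := h i; rewrite gt_max => /andP[].
  by move=> [h1 h2] i; rewrite gt_max h1 h2.
- by move=> _ [c _ <-]; exact: charfun_orthant.
- by move=> k; apply: le_lt_trans (probability_le1 _ (measurable_orthant _)) (ltry _).
Qed.

End characteristic_function_uniqueness.

(** * Characteristic function of the normal law on the line *)

Section is_derive_fun.
Context {R : realType}.
Implicit Types (f g h : R -> R) (x : R).

(** This and the following rules are phrased for explicit functions [fun y => ...], so that a
    derivative is assembled as a term and its value adjusted afterwards by [is_derive_eq]. *)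
Lemma is_derive_fun_cst (c x : R) : is_derive x (1 : R) (fun=> c) (0 : R).
Proof. exact: is_derive_cst. Qed.

Lemma is_derive_fun_id (x : R) : is_derive x (1 : R) (fun y => y) (1 : R).
Proof. exact: is_derive_id. Qed.

Lemma is_derive_funD f g x (df dg : R) : is_derive x (1 : R) f df ->
  is_derive x (1 : R) g dg -> is_derive x (1 : R) (fun y => f y + g y) (df + dg).
Proof. exact: is_deriveD. Qed.

Lemma is_derive_funN f x (df : R) : is_derive x (1 : R) f df ->
  is_derive x (1 : R) (fun y => - f y) (- df).
Proof. exact: is_deriveN. Qed.

Lemma is_derive_funM f g x (df dg : R) : is_derive x (1 : R) f df ->
  is_derive x (1 : R) g dg ->
  is_derive x (1 : R) (fun y => f y * g y) (df * g x + f x * dg).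
Proof.
move=> hf hg; have h := is_deriveM hf hg.
by apply: (is_derive_eq h); rewrite -![_ *: _]/(_ * _) addrC mulrC.
Qed.

Lemma is_derive_funZ f x (c df : R) : is_derive x (1 : R) f df ->
  is_derive x (1 : R) (fun y => c * f y) (c * df).
Proof. exact: is_deriveZ. Qed.

Lemma is_derive_fun_comp h f x (dh df : R) : is_derive (f x) (1 : R) h dh ->
  is_derive x (1 : R) f df -> is_derive x (1 : R) (fun y => h (f y)) (dh * df).
Proof. exact: is_derive1_comp. Qed.

Lemma is_derive_half_sqr x : is_derive x (1 : R) (fun y => y ^+ 2 / 2) x.
Proof.
have h := is_derive_funM (is_derive_funM (is_derive_fun_id x) (is_derive_fun_id x))
  (is_derive_fun_cst (2^-1) x).
by apply: (is_derive_eq h); field.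
Qed.

Lemma is_derive_continuous f x (df : R) : is_derive x (1 : R) f df ->
  {for x, continuous f}.
Proof. by move=> [fx _]; apply: differentiable_continuous; apply/derivable1_diffP. Qed.

End is_derive_fun.

Section normal_characteristic_function.
Context {R : realType}.
Local Notation leb := (@lebesgue_measure R).

Let g (z : R) : R := normal_pdf 0 1 z.

Let gE z : g z = normal_peak 1 * expR (- (z ^+ 2 / 2)).
Proof.
by rewrite /g normal_pdfE ?oner_neq0// /normal_fun subr0 expr1n mulNr.
Qed.

Let g_ge0 z : 0 <= g z. Proof. exact: normal_pdf_ge0. Qed.

Let measurable_g : measurable_fun setT g.
Proof. exact: measurable_normal_pdf. Qed.

Let integrable_g : leb.-integrable setT (EFin \o g).
Proof. exact: integrable_normal_pdf. Qed.

Let is_derive_g z : is_derive z (1 : R) g (- z * g z).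
Proof.
rewrite (_ : g = fun z => normal_peak 1 * expR (- (z ^+ 2 / 2))); last first.
  by apply/funext => ?; rewrite gE.
have h := is_derive_funZ (normal_peak 1) (is_derive_fun_comp (is_derive_expR _)
  (is_derive_funN (is_derive_half_sqr z))).
by apply: (is_derive_eq h); ring.
Qed.

Let continuous_g : continuous g.
Proof. by apply: continuous_normal_pdf; rewrite oner_neq0. Qed.

(* |z| g(z) is dominated by a multiple of the density of variance 2. *)
Let integrable_absg : leb.-integrable setT (fun z => (`|z| * g z)%:E).
Proof.
pose s : R := Num.sqrt 2.
have s0 : s != 0 by rewrite sqrtr_eq0 -ltNge.
have h := integrableZl measurableT (normal_peak 1 / normal_peak s)
  (@integrable_normal_pdf R 0 s).
apply: (le_integrable measurableT _ _ h).
  apply/measurable_EFinP; apply: measurable_funM => //.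
move=> z _; rewrite lee_fin.
rewrite ger0_norm ?mulr_ge0//.
apply: le_trans (ler_norm _).
rewrite gE normal_pdfE// /normal_fun subr0.
have s1 := normal_peak_gt0 s0.
have -> : s ^+ 2 *+ 2 = 4 by rewrite sqr_sqrtr// -mulr_natr; lra.
have -> : normal_peak 1 / normal_peak s * (normal_peak s * expR (- z ^+ 2 / 4))
    = normal_peak 1 * expR (- z ^+ 2 / 4) by field; rewrite gt_eqF.
rewrite mulrCA ler_wpM2l ?normal_peak_ge0//.
have -> : - (z ^+ 2 / 2) = z ^+ 2 / 4 * -1 + - z ^+ 2 / 4 by lra.
rewrite expRD mulrA ler_piMl ?expR_ge0//.
rewrite mulrN1 expRN ler_pdivrMr ?expR_gt0// mul1r.
apply: le_trans (expR_ge1Dx _).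
(* This square gives |z| <= 1 + z^2 / 4 <= exp (z^2 / 4). *)
have : 0 <= (`|z| / 2 - 1) ^+ 2 by rewrite sqr_ge0.
by rewrite -[z ^+ 2]real_normK ?num_real//; lra.
Qed.

Lemma cvg_Rintegral_segment (h : R -> R) : leb.-integrable setT (EFin \o h) ->
  \int[leb]_(z in `[- k%:R, k%:R]) h z @[k --> \oo] --> \int[leb]_z h z.
Proof.
move=> ih; have mh : measurable_fun setT h.
  by apply/measurable_EFinP; case/integrableP : ih.
apply: fine_cvg; rewrite fineK ?integrable_fin_num//.
under eq_fun do rewrite integral_mkcond.
apply: (@dominated_cvg _ _ _ leb setT measurableT _ _ (fun z => `|h z|%:E)).
- move=> k; apply/(measurable_restrictT _ _).1 => //.
  by apply/measurable_EFinP; exact: measurable_funTS.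
- move=> z _.
  apply: (@cvg_trans _ ((fun=> (h z)%:E) @ \oo)); last exact: cvg_cst.
  apply: near_eq_cvg; near=> k; rewrite patchE ifT// inE/= in_itv/= -ler_norml.
  apply: le_trans (ltW (truncnS_gt _)) _; rewrite ler_nat.
  by near: k; exact: nbhs_infty_ge.
- by [].
- exact: integrable_abse ih.
- move=> k z _; rewrite patchE; case: ifP => _ //=.
  by rewrite normr0 lee_fin.
Unshelve. all: by end_near. Qed.

Let integrable_bounded_g (f : R -> R) : measurable_fun setT f ->
  (forall z, `|f z| <= 1) -> leb.-integrable setT (fun z => (f z * g z)%:E).
Proof.
move=> mf f1; apply: (le_integrable measurableT _ _ integrable_g).
  by apply/measurable_EFinP; exact: measurable_funM.
by move=> z _; rewrite lee_fin normrM ler_piMl.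
Qed.

Let integrable_zg (f : R -> R) : measurable_fun setT f ->
  (forall z, `|f z| <= 1) -> leb.-integrable setT (fun z => (f z * (- z * g z))%:E).
Proof.
move=> mf f1; apply: (le_integrable measurableT _ _ integrable_absg).
  apply/measurable_EFinP; apply: measurable_funM => //.
  by apply: measurable_funM => //; exact: measurable_oppr.
move=> z _; rewrite lee_fin !normrM normrN normr_id ler_piMl//.
Qed.

Let measurable_cos_lin s b : measurable_fun setT (fun z : R => cos (s * z + b)).
Proof.
apply: measurableT_comp; first exact: measurable_cos.
by apply: measurable_funD => //; apply: measurable_funM.
Qed.

Let measurable_sin_lin s b : measurable_fun setT (fun z : R => sin (s * z + b)).
Proof.
apply: measurableT_comp; first exact: measurable_sin.
by apply: measurable_funD => //; apply: measurable_funM.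
Qed.

Let is_derive_sin_lin s b z :
  is_derive z (1 : R) (fun z : R => sin (s * z + b)) (s * cos (s * z + b)).
Proof.
have h := is_derive_fun_comp (is_derive_sin _)
  (is_derive_funD (is_derive_funZ s (is_derive_fun_id z)) (is_derive_fun_cst b z)).
by apply: (is_derive_eq h); ring.
Qed.

Let C b s := \int[leb]_z (cos (s * z + b) * g z).

(** Since - z g(z) is the derivative of g, integration by parts on [- k, k] moves it onto the sine,
    and the boundary terms vanish in the limit. *)
Let by_parts b s :
  \int[leb]_z (sin (s * z + b) * (- z * g z)) = - (s * C b s).
Proof.
have i1 := integrable_zg (measurable_sin_lin s b) (fun z => sin_max _).
have i2 := integrable_bounded_g (measurable_cos_lin s b) (fun z => cos_max _).
have c1 := cvg_Rintegral_segment i1.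
have c2 := cvg_Rintegral_segment i2.
have cfp : continuous (fun z => s * cos (s * z + b)).
  move=> z; exact: (is_derive_continuous (is_derive_funZ s (is_derive_fun_comp
    (is_derive_cos _) (is_derive_funD (is_derive_funZ s (is_derive_fun_id z))
      (is_derive_fun_cst b z))))).
pose bd k : R := sin (s * k%:R + b) * g k%:R - sin (s * - k%:R + b) * g (- k%:R).
(* The index is shifted by one because integration by parts asks for distinct endpoints. *)
have e k : \int[leb]_(z in `[- k.+1%:R, k.+1%:R]) (sin (s * z + b) * (- z * g z)) =
    bd k.+1 - s * \int[leb]_(z in `[- k.+1%:R, k.+1%:R]) (cos (s * z + b) * g z).
  have ab : - k.+1%:R < k.+1%:R :> R.
    have : 0 < k.+1%:R :> R by rewrite ltr0n.
    lra.
  rewrite (@Rintegration_by_parts R (fun z => sin (s * z + b)) g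
    (fun z => s * cos (s * z + b)) _ _ _ ab).
  - rewrite -RintegralZl//; last exact: integrableS i2.
    by rewrite /bd; congr (_ - _); apply: eq_Rintegral => z _; rewrite mulrA.
  - by apply: continuous_subspaceT => z; exact: cfp.
  - split=> [z _||].
    + by have [] := is_derive_sin_lin s b z.
    + apply: cvg_at_right_filter; exact: (is_derive_continuous (is_derive_sin_lin s b _)).
    + apply: cvg_at_left_filter; exact: (is_derive_continuous (is_derive_sin_lin s b _)).
  - by move=> z _; rewrite derive1E; have [_ ->] := is_derive_sin_lin s b z.
  - apply: continuous_subspaceT => z.
    apply: (@cvgM _ _ _ _ (fun z : R => - z) g); last exact: continuous_g.
    by apply: cvgN; exact: cvg_id.
  - split=> [z _||].
    + by have [] := is_derive_g z.
    + by apply: cvg_at_right_filter; exact: continuous_g.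
    + by apply: cvg_at_left_filter; exact: continuous_g.
  - by move=> z _; rewrite derive1E; have [_ ->] := is_derive_g z.
have cbd : bd k @[k --> \oo] --> (0 : R).
  have gk0 : g k%:R @[k --> \oo] --> (0 : R).
    have c0 := @normal_peak_ge0 R 1.
    apply: (@squeeze_cvgr _ _ _ _ (cst 0) (fun k => 2 * normal_peak 1 * k.+1%:R^-1)).
    - near=> k; rewrite g_ge0/= gE -mulrA mulrCA ler_wpM2l//.
      have k0 : 0 <= k%:R :> R by [].
      have h : k.+1%:R / 2 <= expR (k%:R ^+ 2 / 2) :> R.
        by apply: le_trans (expR_ge1Dx _); rewrite -(natr1 k); nra.
      rewrite expRN -[leRHS]invf_div lef_pV2 ?posrE ?expR_gt0//.
    - exact: cvg_cst.
    - rewrite -[X in _ --> X](mulr0 (2 * normal_peak 1)).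
      exact: cvgM (cvg_cst _) cvg_harmonic.
  have gk1 : 2 * g k%:R @[k --> \oo] --> (0 : R).
    by rewrite -[X in _ --> X](mulr0 2); exact: cvgM (cvg_cst _) gk0.
  apply: (@squeeze_cvgr _ _ _ _ (fun k => - (2 * g k%:R)) (fun k => 2 * g k%:R)).
  - near=> k; rewrite -ler_norml /bd.
    rewrite (_ : g (- k%:R) = g k%:R) -?mulrBl; last by rewrite !gE sqrrN.
    rewrite normrM (ger0_norm (g_ge0 _)) ler_wpM2r ?g_ge0//.
    apply: le_trans (ler_normB _ _) _; apply: lerD; exact: sin_max.
  - by rewrite -oppr0; exact: cvgN gk1.
  - exact: gk1.
have c3 : bd k - s * \int[leb]_(z in `[- k%:R, k%:R]) (cos (s * z + b) * g z)
    @[k --> \oo] --> 0 - s * C b s.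
  by apply: cvgB => //; exact: cvgM (cvg_cst _) c2.
have c4 : bd k - s * \int[leb]_(z in `[- k%:R, k%:R]) (cos (s * z + b) * g z)
    @[k --> \oo] --> \int[leb]_z (sin (s * z + b) * (- z * g z)).
  apply: cvg_trans c1; apply: near_eq_cvg; near=> k.
  have k0 : (0 < k)%N by near: k; exact: nbhs_infty_gt.
  by rewrite -(prednK k0) e.
rewrite -(cvg_lim (@Rhausdorff R) c4) (cvg_lim (@Rhausdorff R) c3).
by rewrite sub0r.
Unshelve. all: by end_near. Qed.

(** Differentiation under the integral, dominated by |z| g(z) uniformly in s, followed by
    [by_parts]: the outcome is a linear differential equation for [C b]. *)
Let is_derive_C b s : is_derive s (1 : R) (C b) (- (s * C b s)).
Proof.
pose f (t z : R) : R := cos (t * z + b) * g z.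
have df t z : is_derive t (1 : R) (f ^~ z) (sin (t * z + b) * (- z * g z)).
  have h := is_derive_funM (is_derive_fun_comp (is_derive_cos _)
    (is_derive_funD (is_derive_funM (is_derive_fun_id t) (is_derive_fun_cst z t))
       (is_derive_fun_cst b t))) (is_derive_fun_cst (g z) t).
  by apply: (is_derive_eq h); ring.
have pE t z : partial1of2 f t z = sin (t * z + b) * (- z * g z).
  by rewrite partial1of2E; have [_ ->] := df t z.
have Ia : `]s - 1, s + 1[%classic s by rewrite /= in_itv/=; lra.
have intf t : `]s - 1, s + 1[%classic t -> leb.-integrable setT (EFin \o f t).
  move=> _; apply: integrable_bounded_g; first exact: measurable_cos_lin.
  by move=> z; exact: cos_max.
have d1 (t z : R) : `]s - 1, s + 1[%classic t -> [set: R] z -> derivable (f ^~ z) t 1.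
  by move=> _ _; have [] := df t z.
have bnd (t z : R) : `]s - 1, s + 1[%classic t -> [set: R] z ->
    `|partial1of2 f t z| <= `|z| * g z.
  move=> _ _; rewrite pE !normrM normrN (ger0_norm (g_ge0 _)) ler_piMl//.
    by rewrite mulr_ge0.
  exact: sin_max.
have G0 (z : R) : 0 <= `|z| * g z by rewrite mulr_ge0.
have D := derivable_under_integral measurableT Ia intf d1 G0 integrable_absg bnd.
have E := differentiation_under_integral measurableT Ia intf d1 G0 integrable_absg bnd.
apply: DeriveDef => //.
rewrite -derive1E E -by_parts.
by apply: eq_Rintegral => z _; rewrite pE.
Qed.

(** By the differential equation C(s) e^{s^2/2} is constant; at s = 0 it is cos b times the total
    mass of the density. *)
Let CE b s : C b s = cos b * expR (- (s ^+ 2 / 2)).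
Proof.
pose F s := C b s * expR (s ^+ 2 / 2).
have dF t : is_derive t (1 : R) F 0.
  have h := is_derive_funM (is_derive_C b t)
    (is_derive_fun_comp (is_derive_expR _) (is_derive_half_sqr t)).
  by apply: (is_derive_eq h); ring.
have := is_derive_0_is_cst s 0 dF.
rewrite /F expr0n mul0r expR0 mulr1 => Fs.
have -> : cos b = C b 0.
  rewrite /C; under eq_Rintegral do rewrite mul0r add0r.
  rewrite RintegralZl//.
  by rewrite /Rintegral integral_normal_pdf mulr1.
by rewrite -Fs -mulrA -expRD subrr expR0 mulr1.
Qed.

Lemma Rintegral_normal_prob (f : R -> R) :
  (normal_prob 0 1).-integrable setT (EFin \o f) ->
  \int[normal_prob 0 1]_x f x = \int[leb]_x (f x * normal_pdf 0 1 x).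
Proof.
move=> intf.
have dom := @normal_prob_dominates R 0 1.
rewrite /Rintegral -(Radon_Nikodym_change_of_variables dom)//=.
congr fine; apply: ae_eq_integral => //=.
- apply: emeasurable_funM => //; first exact: measurable_int intf.
- apply/measurable_EFinP; apply: measurable_funM => //.
  by apply/measurable_EFinP; exact: measurable_int intf.
- under [X in ae_eq _ _ _ X]eq_fun do rewrite EFinM.
  apply: ae_eqe_mul2l => /=.
  rewrite Radon_NikodymE//=.
  case: cid => /= h [h1 h2 h3].
  apply: integral_ae_eq => //=.
  + by apply/measurable_EFinP; exact: measurable_normal_pdf.
  + by move=> E E01 mE; rewrite -h3.
Qed.

Theorem charfun_normal (s b : R) :
  \int[normal_prob 0 1]_z cos (s * z + b) = cos b * expR (- (s ^+ 2 / 2)).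
Proof.
rewrite Rintegral_normal_prob; first exact: CE.
apply: (@bounded_integrable _ _ _ (normal_prob 0 1) _ 1); first exact: measurable_cos_lin.
by move=> z; exact: cos_max.
Qed.

End normal_characteristic_function.

(** * Sums of independent Gaussian variables *)

Section independence.
Context {R : realType} {d : measure_display} {Omega : measurableType d}.
Variable P : probability Omega R.

Lemma Rintegral_distribution d' (T : measurableType d') (X : {RV P >-> T})
    (f : T -> R) (M : R) : measurable_fun setT f -> (forall x, `|f x| <= M) ->
  \int[distribution P X]_y f y = \int[P]_w f (X w).
Proof.
move=> mf fM; rewrite /Rintegral integral_distribution//.
  exact/measurable_EFinP.
by apply: (@bounded_integrable _ _ _ P _ M) => //; exact: measurableT_comp.
Qed.

(** For fixed E both sides are finite measures in D. They agree on rectangles, which are stable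
    under intersection and generate the product sigma-algebra. *)
Lemma independent_pair (S U : {RV P >-> R}) (E : set Omega) : measurable E ->
  (forall C B, measurable C -> measurable B ->
     P ((S @^-1` C `&` U @^-1` B) `&` E) = (P (S @^-1` C `&` U @^-1` B) * P E)%E) ->
  forall D, measurable D ->
    P ([set w | D (S w, U w)] `&` E) = (P [set w | D (S w, U w)] * P E)%E.
Proof.
move=> mE hCB D mD.
have mSU : measurable_fun setT (fun w => (S w, U w)).
  by apply: measurable_fun_pair.
pose SU : {mfun Omega >-> (R * R)%type} := mfun_Sub (mem_set mSU).
have PE : P E \is a fin_num by exact: fin_num_measure.
pose c : {nonneg R} := NngNum (fine_ge0 (measure_ge0 P E)).
have mscaleE X : mscale c (pushforward P SU) X = (P (SU @^-1` X) * P E)%E.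
  by rewrite -[in RHS](fineK PE) muleC.
have := @g_sigma_algebra_measure_unique _ R (R * R)%type
  [set A `*` B | A in measurable & B in measurable] _ (fun=> setT) _ _
  (pushforward (mrestr P mE) SU) (mscale c (pushforward P SU)) _ _ _ D.
rewrite -measurable_prod_measurableType => /(_ _ _ _ mSU mSU _ _ _ mD) h.
transitivity (pushforward (mrestr P mE) SU D); first by [].
rewrite h.
- exact: mscaleE.
- by move=> _ [A mA [B mB <-]]; exact: measurableX.
- by move=> _; exists setT => //; exists setT => //; rewrite setXTT.
- by rewrite bigcup_const//; exists 0%N.
- move=> _ _ [A1 mA1 [B1 mB1 <-]] [A2 mA2 [B2 mB2 <-]].
  exists (A1 `&` A2); first exact: measurableI.
  by exists (B1 `&` B2); [exact: measurableI|rewrite setXI].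
- move=> _ [A mA [B mB <-]].
  transitivity (P (SU @^-1` (A `*` B)) * P E)%E; first exact: hCB.
  exact/esym/(mscaleE mSU).
- move=> _; change (P (SU @^-1` setT `&` E) < +oo)%E.
  by rewrite preimage_setT setTI; exact: le_lt_trans (probability_le1 P mE) (ltry _).
Qed.

Lemma Rintegral_cst_probability (c : R) : \int[P]_w c = c.
Proof.
rewrite Rintegral_cst// [X in fine X](_ : _ = 1%E) ?mulr1//.
exact: probability_setT.
Qed.

(** The characteristic function is tested at frequency 1 only: in the applications the frequency is
    already contained in U, and b recovers the real and the imaginary part. *)
Definition gaussian_charfun (U : Omega -> R) (v : R) : Prop :=
  forall b, \int[P]_w cos (U w + b) = cos b * expR (- (v / 2)).

Lemma measurable_cos_shift (b : R) : measurable_fun setT (fun y : R => cos (y + b)).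
Proof. by apply: measurableT_comp; [exact: measurable_cos|exact: measurable_funD]. Qed.

(** Independence makes the joint law a product, and Fubini integrates U first, the value of S being
    absorbed in the phase b. *)
Lemma gaussian_charfunD (S U : {RV P >-> R}) (V v : R) :
  (forall C B, measurable C -> measurable B ->
     P (S @^-1` C `&` U @^-1` B) = (P (S @^-1` C) * P (U @^-1` B))%E) ->
  gaussian_charfun S V -> gaussian_charfun U v ->
  gaussian_charfun (fun w => S w + U w) (V + v).
Proof.
move=> hCB hS hU b.
have mSU : measurable_fun setT (fun w => (S w, U w)).
  by apply: measurable_fun_pair.
pose SU : {RV P >-> (R * R)%type} := mfun_Sub (mem_set mSU).
pose PS : probability R R := distribution P S.
pose PU : probability R R := distribution P U.
have prodE D : measurable D -> distribution P SU D = (PS \x PU)%E D.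
  move=> mD; apply/esym/product_measure_unique => // A B mA mB.
have mf : measurable_fun setT (fun z : R * R => cos (z.1 + z.2 + b)).
  apply: (measurableT_comp (measurable_cos_shift b)).
  exact: measurable_funD.
have fb (x : R) : `|cos x| <= 1 by exact: cos_max.
transitivity (\int[distribution P SU]_z cos (z.1 + z.2 + b)).
  by rewrite (Rintegral_distribution SU mf (fun z => fb _)).
have -> : \int[distribution P SU]_z cos (z.1 + z.2 + b) =
    \int[(PS \x PU)%E]_z cos (z.1 + z.2 + b).
  rewrite /Rintegral; congr fine; apply: eq_measure_integral => A mA _.
  exact: prodE.
have intf : (PS \x PU)%E.-integrable setT
    (fun z : R * R => (cos (z.1 + z.2 + b))%:E).
  exact: (@bounded_integrable _ _ _ (PS \x PU)%E _ 1).
rewrite /Rintegral -integral12_prod_meas1//.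
have inner_int s : (\int[PU]_u (cos (s + u + b))%:E)%E =
    (cos (s + b) * expR (- (v / 2)))%:E.
  have ms : measurable_fun setT (fun u : R => cos (s + u + b)).
    apply: (measurableT_comp (measurable_cos_shift b)).
    exact: measurable_funD.
  rewrite -(hU (s + b)) -[LHS]fineK; last first.
    by apply: integrable_fin_num => //; exact: (@bounded_integrable _ _ _ PU _ 1).
  congr EFin.
  have := Rintegral_distribution U ms (fun z => fb _); rewrite {1}/Rintegral => ->.
  by apply: eq_Rintegral => w _; congr cos; ring.
under eq_integral do rewrite /fubini_F/= inner_int.
have -> : fine (\int[PS]_x (cos (x + b) * expR (- (v / 2)))%:E)%E =
   \int[PS]_x (cos (x + b) * expR (- (v / 2))) by [].
rewrite RintegralZr//; last first.
  by apply: (@bounded_integrable _ _ _ PS _ 1) => //; exact: measurable_cos_shift.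
rewrite (Rintegral_distribution S (measurable_cos_shift b) (fun z => fb _)) hS.
by rewrite -mulrA -expRD; congr (_ * expR _); lra.
Qed.

Lemma measurable_forall (I : finType) (Q : pred I) (A : I -> set Omega) :
  (forall i, measurable (A i)) -> measurable [set w | forall i, Q i -> A i w].
Proof.
by move=> mA; apply: (@fin_bigcap_measurable _ _ _ [set i | Q i] A) => // i _.
Qed.

Section sum.
Variables (k : nat) (U : 'I_k -> {RV P >-> R}) (v : 'I_k -> R).
Hypothesis indepU : mutually_independent P (fun i w => U i w).
Hypothesis gaussU : forall i, gaussian_charfun (U i) (v i).

Let partial_sum j w : R := \sum_(i < k | (i < j)%N) U i w.

Let measurable_partial_sum j : measurable_fun setT (partial_sum j).
Proof.
rewrite /partial_sum; under eq_fun do rewrite -big_filter.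
by apply: measurable_sum => i; exact: measurable_funP.
Qed.

Let S j : {RV P >-> R} := mfun_Sub (mem_set (measurable_partial_sum j)).

Let tail j (B : 'I_k -> set R) : set Omega :=
  [set w | forall i : 'I_k, (j <= i)%N -> B i (U i w)].

Let measurable_tail j B : (forall i, measurable (B i)) -> measurable (tail j B).
Proof.
move=> mB; apply: measurable_forall => i.
by rewrite -[X in measurable X]setTI; exact: measurable_funP.
Qed.

Let partial_sumS j (jk : (j < k)%N) w :
  partial_sum j.+1 w = partial_sum j w + U (Ordinal jk) w.
Proof.
rewrite /partial_sum (bigD1 (Ordinal jk))//= addrC; congr (_ + _).
apply: eq_bigl => i; rewrite ltnS -val_eqE /=.
by rewrite andbC -ltn_neqAle.
Qed.

(** Only the test set of the variable of index j is changed, which detaches this variable from the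
    tail. *)
Let independent_step j (jk : (j < k)%N) :
  (forall C B, measurable C -> (forall i, measurable (B i)) ->
  P (S j @^-1` C `&` tail j B) =
    (P (S j @^-1` C) * \prod_(i < k | (j <= i)%N) P (U i @^-1` B i))%E) ->
  forall C B0 B, measurable C -> measurable B0 -> (forall i, measurable (B i)) ->
    P ((S j @^-1` C `&` U (Ordinal jk) @^-1` B0) `&` tail j.+1 B) =
    (P (S j @^-1` C) * (P (U (Ordinal jk) @^-1` B0) *
       \prod_(i < k | (j.+1 <= i)%N) P (U i @^-1` B i)))%E.
Proof.
move=> IH C B0 B mC mB0 mB; set i0 := Ordinal jk.
pose B2 i := if i == i0 then B0 else B i.
have mB2 i : measurable (B2 i) by rewrite /B2; case: ifP.
transitivity (P (S j @^-1` C `&` tail j B2)).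
  congr (P _); rewrite -setIA; congr (_ `&` _).
  apply/seteqP; split=> w /=.
    move=> [h0 h] i ji; rewrite /B2; case: eqVneq => [->//|ne].
    apply: h; rewrite ltn_neqAle ji andbT; apply: contra ne => /eqP ji'.
    by apply/eqP/val_inj.
  move=> h; split; first by have := h i0 (leqnn _); rewrite /B2 eqxx.
  move=> i ji; have := h i (ltnW ji); rewrite /B2 ifF//.
  by apply/negbTE; apply: contraL ji => /eqP ->; rewrite ltnn.
rewrite IH// (bigD1 i0)//= {1}/B2 eqxx; congr (_ * (_ * _))%E.
apply: eq_big => [i|i /andP[_ ne]]; last by rewrite /B2 (negbTE ne).
by rewrite andbC -val_eqE /= eq_sym -ltn_neqAle.
Qed.

(** The induction must carry the whole tail, not only the next variable. By [independent_step] the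
    rectangles in (S_j, U_j) are independent of the tail beyond j, hence so is every event of that
    pair, in particular S_j + U_j in C. *)
Let independent_tail j : (j <= k)%N -> forall C B, measurable C ->
  (forall i, measurable (B i)) ->
  P (S j @^-1` C `&` tail j B) =
    (P (S j @^-1` C) * \prod_(i < k | (j <= i)%N) P (U i @^-1` B i))%E.
Proof.
elim: j => [_|j IH jk] C B mC mB.
  (* The empty sum is the constant 0, so its event is either everything or empty. *)
  have [C0|C0] := pselect (C 0).
    have -> : S 0 @^-1` C = setT.
      by apply/seteqP; split=> w //= _; rewrite /partial_sum big_pred0.
    rewrite setTI (probability_setT P) mul1e -(indepU mB).
    by congr (P _); apply/seteqP; split=> w /=; [move=> h i; exact: h|move=> h i _; exact: h].
  have -> : S 0 @^-1` C = set0.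
    by apply/seteqP; split=> w //=; rewrite /partial_sum big_pred0.
  by rewrite set0I measure0 mul0e.
have step := independent_step jk (IH (ltnW jk)).
pose i0 := Ordinal jk.
have prodT : (\prod_(i < k | (j.+1 <= i)%N) P (U i @^-1` [set: R]))%E = 1%E.
  by apply: big1 => i _; rewrite preimage_setT (probability_setT P).
have tailT : tail j.+1 (fun=> setT) = setT by apply/seteqP; split.
have Ptail : P (tail j.+1 B) = (\prod_(i < k | (j.+1 <= i)%N) P (U i @^-1` B i))%E.
  have := step setT setT B measurableT measurableT mB.
  by rewrite !preimage_setT !setTI (probability_setT P) !mul1e.
have pairE C' B0 : measurable C' -> measurable B0 ->
    P (S j @^-1` C' `&` U i0 @^-1` B0) = (P (S j @^-1` C') * P (U i0 @^-1` B0))%E.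
  move=> mC' mB0; have := step C' B0 (fun=> setT) mC' mB0 (fun=> measurableT).
  by rewrite prodT tailT setIT mule1.
pose D : set (R * R) := [set z | C (z.1 + z.2)].
have mD : measurable D.
  rewrite -[D]setTI; apply: (measurable_funD _ _ _ mC) => //.
have := @independent_pair (S j) (U i0) (tail j.+1 B) (measurable_tail _ mB) _ D mD.
rewrite (_ : [set w | D (S j w, U i0 w)] = S j.+1 @^-1` C); last first.
  by apply/seteqP; split=> w /=; rewrite partial_sumS.
rewrite Ptail; apply => C' B0 mC' mB0.
by rewrite step// muleA pairE.
Qed.

Lemma gaussian_charfun_sum :
  gaussian_charfun (fun w => \sum_(i < k) U i w) (\sum_(i < k) v i).
Proof.
suff H j : (j <= k)%N -> gaussian_charfun (S j) (\sum_(i < k | (i < j)%N) v i).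
  move=> b; have sumE (F : 'I_k -> R) : \sum_(i < k | (i < k)%N) F i = \sum_(i < k) F i.
    by apply: eq_bigl => i; rewrite ltn_ord.
  rewrite -sumE -(H k (leqnn k) b); apply: eq_Rintegral => w _.
  by rewrite /= /partial_sum sumE.
elim: j => [_ b|j IH jk].
  under eq_Rintegral do rewrite /= /partial_sum big_pred0// add0r.
  rewrite big_pred0// mul0r oppr0 expR0 mulr1.
  exact: Rintegral_cst_probability.
have -> : \sum_(i < k | (i < j.+1)%N) v i =
    \sum_(i < k | (i < j)%N) v i + v (Ordinal jk).
  rewrite (bigD1 (Ordinal jk))//= addrC; congr (_ + _).
  by apply: eq_bigl => i; rewrite ltnS -val_eqE /= andbC -ltn_neqAle.
move=> b; have := gaussian_charfunD _ (IH (ltnW jk)) (gaussU (Ordinal jk)).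
move=> /(_ _ b) <-.
  by apply: eq_Rintegral => w _; rewrite /= partial_sumS.
move=> C B0 mC mB0.
have := independent_step jk (independent_tail (ltnW jk)) mC mB0 (fun=> measurableT).
rewrite (_ : tail _ _ = setT) ?setIT; last by apply/seteqP; split.
by rewrite big1 ?mule1// => i _; rewrite preimage_setT (probability_setT P).
Qed.

End sum.

End independence.

(** * Gaussian vectors and Brownian increments *)

Section inner_product.
Context {R : realType}.

Lemma innerE n (u v : 'cV[R]_n) : inner u v = (u^T *m v) 0 0.
Proof. by rewrite mxE; apply: eq_bigr => i _; rewrite mxE. Qed.

Lemma innerC n (u v : 'cV[R]_n) : inner u v = inner v u.
Proof. by apply: eq_bigr => i _; rewrite mulrC. Qed.

Lemma innerDr n (u v x : 'cV[R]_n) : inner x (u + v) = inner x u + inner x v.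
Proof. by rewrite innerC innerDl !(innerC x). Qed.

Lemma innerZr n a (u x : 'cV[R]_n) : inner x (a *: u) = a * inner x u.
Proof. by rewrite innerC innerZl innerC. Qed.

Lemma innerNr n (u x : 'cV[R]_n) : inner x (- u) = - inner x u.
Proof. by rewrite innerC innerNl innerC. Qed.

Lemma inner0r n (x : 'cV[R]_n) : inner x 0 = 0.
Proof. by rewrite innerC inner0l. Qed.

Lemma inner_sumr n (I : Type) (r : seq I) (Q : pred I) (F : I -> 'cV[R]_n) x :
  inner x (\sum_(i <- r | Q i) F i) = \sum_(i <- r | Q i) inner x (F i).
Proof.
by apply: (big_morph (inner x)) => [u v|]; [exact: innerDr|exact: inner0r].
Qed.

Lemma inner_mulmx m n (M : 'M[R]_(m, n)) (u : 'cV[R]_m) (z : 'cV[R]_n) :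
  inner u (M *m z) = inner (M^T *m u) z.
Proof. by rewrite !innerE trmx_mul trmxK mulmxA. Qed.

End inner_product.

Section gaussian_laws.
Context {R : realType}.

Lemma measurable_mulmx_col m n (M : 'M[R]_(m, n)) :
  measurable_fun setT (fun z : 'cV[R]_n => M *m z).
Proof.
apply: measurable_fun_col => i; under eq_fun do rewrite mxE.
apply: measurable_sum => j; apply: measurable_funM => //; exact: measurable_coord.
Qed.

Lemma measurable_addmx d (T : measurableType d) n (f g : T -> 'cV[R]_n) :
  measurable_fun setT f -> measurable_fun setT g ->
  measurable_fun setT (fun w => f w + g w).
Proof.
move=> mf mg; apply: measurable_fun_col => i; under eq_fun do rewrite mxE.
apply: measurable_funD.
  exact: (measurableT_comp (measurable_coord i) mf).
exact: (measurableT_comp (measurable_coord i) mg).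
Qed.

Lemma measurable_oppmx d (T : measurableType d) n (f : T -> 'cV[R]_n) :
  measurable_fun setT f -> measurable_fun setT (fun w => - f w).
Proof.
move=> mf; apply: measurable_fun_col => i; under eq_fun do rewrite mxE -mulN1r.
apply: measurable_funM => //.
exact: (measurableT_comp (measurable_coord i) mf).
Qed.

Lemma measurable_affine m n (a : 'cV[R]_m) (M : 'M[R]_(m, n)) :
  measurable_fun setT (fun z : 'cV[R]_n => a + M *m z).
Proof.
by apply: measurable_addmx; [exact: measurable_cst|exact: measurable_mulmx_col].
Qed.

(** [normal_prob 0 1] is a measure on [measurableTypeR R], a measurable structure on the reals
    declared apart from that of [R]; the identity transports integrals from one to the other. *)
Lemma measurable_id_measurableTypeR :
  @measurable_fun _ _ (measurableTypeR R) R setT (fun x => x).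
Proof. by move=> _ Y mY; rewrite setTI preimage_id. Qed.

Lemma Rintegral_eq_normal_prob (D : probability R R) (f : R -> R) (M : R) :
  (forall B, measurable B -> D B = normal_prob 0 1 B) ->
  measurable_fun setT f -> (forall x, `|f x| <= M) ->
  \int[D]_x f x = \int[normal_prob 0 1]_x f x.
Proof.
move=> DE mf fM.
pose J : {mfun measurableTypeR R >-> R} :=
  @mfun_Sub _ _ (measurableTypeR R) R (fun x => x) (mem_set measurable_id_measurableTypeR).
transitivity (\int[distribution (normal_prob 0 1) J]_x f x).
  by rewrite /Rintegral; congr fine; apply: eq_measure_integral => B mB _; exact: DE.
exact: (Rintegral_distribution J mf fM).
Qed.

(** The product rule makes the coordinates independent, and with all other sets full it gives their
    marginals. So <u, z> is a sum of independent centred Gaussians of variances u_i^2. *)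
Lemma charfun_standard_gaussian n (N : probability 'cV[R]_n R) u b :
  standard_gaussian N ->
  \int[N]_z cos (inner u z + b) = cos b * expR (- (inner u u / 2)).
Proof.
move=> gN.
have mcoord (i : 'I_n) : measurable_fun setT (fun z : 'cV[R]_n => z i ord0).
  exact: measurable_coord.
pose Z (i : 'I_n) : {RV N >-> R} := mfun_Sub (mem_set (mcoord i)).
have lawZ i B : measurable B -> N [set z : 'cV[R]_n | B (z i ord0)] = normal_prob 0 1 B.
  move=> mB.
  have := gN (fun j => if j == i then B else setT).
  rewrite (bigD1 i)//= eqxx big1 ?mule1; last first.
    by move=> j /negbTE ->; rewrite (probability_setT (normal_prob 0 1)).
  move=> <-; last by move=> j; case: ifP.
  congr (N _); apply/seteqP; split=> z /=; last by move/(_ i); rewrite eqxx.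
  by move=> Bz j; case: eqVneq => [->|].
have mU (i : 'I_n) : measurable_fun setT (fun z : 'cV[R]_n => u i ord0 * z i ord0).
  by apply: measurable_funM.
pose U (i : 'I_n) : {RV N >-> R} := mfun_Sub (mem_set (mU i)).
apply: (@gaussian_charfun_sum _ _ _ N n U (fun i => u i 0 * u i 0)).
- move=> B mB.
  have mB' i : measurable [set y : R | B i (u i ord0 * y)].
    rewrite -[X in measurable X]setTI.
    have mh : measurable_fun setT (fun y : R => u i ord0 * y) by exact: measurable_funM.
    exact: mh.
  rewrite [LHS](gN (fun i => [set y | B i (u i ord0 * y)])) //.
  by apply: eq_bigr => i _; rewrite -(lawZ i).
- move=> i c.
  have mf : measurable_fun setT (fun y : R => cos (u i ord0 * y + c)).
    apply: measurableT_comp; first exact: measurable_cos.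
    by apply: measurable_funD => //; exact: measurable_funM.
  have fb (y : R) : `|cos (u i ord0 * y + c)| <= 1 by exact: cos_max.
  have := Rintegral_distribution (Z i) mf fb => /= <-.
  rewrite -expr2 -charfun_normal; apply: (Rintegral_eq_normal_prob _ mf fb).
  exact: lawZ.
Qed.

(** The square root S passes to u as its transpose, and |S^T u|^2 = <u, Sigma u>. *)
Lemma charfun_gaussian_law n a (Sigma : 'M[R]_n) (Q : probability 'cV[R]_n R) u b :
  gaussian_law a Sigma Q ->
  \int[Q]_x cos (inner u x + b) =
    cos (inner u a + b) * expR (- (inner u (Sigma *m u) / 2)).
Proof.
move=> [S [N [SS gN QE]]].
pose X : {RV N >-> 'cV[R]_n} := mfun_Sub (mem_set (measurable_affine a S)).
transitivity (\int[distribution N X]_x cos (inner u x + b)).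
  by rewrite /Rintegral; congr fine; apply: eq_measure_integral => B mB _; exact: QE.
rewrite (Rintegral_distribution X (measurable_cos_inner u b) (fun x => cos_max _)).
have -> : \int[N]_w cos (inner u (X w) + b) =
   \int[N]_w cos (inner (S^T *m u) w + (inner u a + b)).
  by apply: eq_Rintegral => w _ /=; rewrite innerDr inner_mulmx; congr cos; ring.
rewrite charfun_standard_gaussian//; congr (_ * expR (- (_ / 2))).
by rewrite -inner_mulmx mulmxA SS.
Qed.

Section brownian_increments.
Context {d : measure_display} {Omega : measurableType d}.
Variables (P : probability Omega R) (n : nat) (L : R -> {RV P >-> 'cV[R]_n}).
Hypothesis hL : standard_brownian_motion L.

Lemma charfun_brownian_sum (k : nat) (t : nat -> R) (c : nat -> 'cV[R]_n) :
  0 <= t 0%N -> (forall j, (j < k)%N -> t j < t j.+1) ->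
  gaussian_charfun P
    (fun w => \sum_(j < k) inner (c j) (L (t j.+1) w - L (t j) w))
    (\sum_(j < k) (t j.+1 - t j) * inner (c j) (c j)).
Proof.
move=> t0 tS; have [_ _ indepL gaussL] := hL.
have t_ge0 j : (j <= k)%N -> 0 <= t j.
  by elim: j => // j IH jk; apply: le_trans (IH (ltnW jk)) (ltW (tS _ jk)).
have mD j : measurable_fun setT (fun w => L (t j.+1) w - L (t j) w).
  by apply: measurable_addmx => //; exact: measurable_oppmx.
pose D j : {RV P >-> 'cV[R]_n} := mfun_Sub (mem_set (mD j)).
have mU (j : 'I_k) : measurable_fun setT (fun w => inner (c j) (L (t j.+1) w - L (t j) w)).
  exact: (measurableT_comp (measurable_inner (c j)) (mD j)).
pose U (j : 'I_k) : {RV P >-> R} := mfun_Sub (mem_set (mU j)).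
apply: (@gaussian_charfun_sum _ _ _ P k U (fun j => (t j.+1 - t j) * inner (c j) (c j))).
- move=> B mB.
  apply: (indepL k t t0 tS (fun j => inner (c j) @^-1` B j)) => j.
  by rewrite -[X in measurable X]setTI; exact: measurable_inner.
- move=> j b.
  rewrite -(Rintegral_distribution (D j) (measurable_cos_inner (c j) b) (fun x => cos_max _)).
  have := gaussL _ _ (t_ge0 _ (ltnW (ltn_ord j))) (tS j (ltn_ord j)).
  move=> /(@charfun_gaussian_law _ _ _ (distribution P (D j)) (c j) b) ->.
  by rewrite inner0r add0r mul_scalar_mx innerZr.
Qed.

End brownian_increments.

End gaussian_laws.

Lemma cvg_sum_seq (R : realType) (T : Type) (F : set_system T) (FF : Filter F)
    (I : Type) (r : seq I) (f : T -> I -> R) (l : I -> R) :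
  (forall i, f x i @[x --> F] --> l i) ->
  \sum_(i <- r) f x i @[x --> F] --> \sum_(i <- r) l i.
Proof.
move=> fl; elim: r => [|i r IH].
  under eq_fun do rewrite big_nil.
  by rewrite big_nil; exact: cvg_cst.
under eq_fun do rewrite big_cons.
by rewrite big_cons; apply: cvgD.
Qed.

(** * Matrix exponential and its derivative *)

Section matrix_exponential.
Context {R : realType} {n : nat}.
Implicit Types (M N : 'M[R]_n) (s : R).

Lemma cvg_mx (u : nat -> 'M[R]_n) (l : 'M[R]_n) :
  (forall i j, u k i j @[k --> \oo] --> l i j) -> u k @[k --> \oo] --> l.
Proof.
move=> ul A [P Pl PA].
have : \forall k \near \oo, forall i j, P i j (u k i j).
  apply: filter_forall => i; apply: filter_forall => j; apply: ul; exact: Pl.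
by apply: filterS => k kP; exact: PA.
Qed.

(** The left factor N makes this family of power series stable under differentiation, which replaces
    N by N M. *)
Definition expmx_coef N M (i j : 'I_n) (k : nat) : R :=
  k`!%:R^-1 * (N *m M ^+ k) i j.

Lemma exprmxS M k : M ^+ k.+1 = M *m M ^+ k. Proof. by rewrite exprS. Qed.

Lemma exprmxSr M k : M ^+ k.+1 = M ^+ k *m M. Proof. by rewrite exprSr. Qed.

Lemma pseries_diffs_expmx_coef N M i j :
  pseries_diffs (expmx_coef N M i j) = expmx_coef (N *m M) M i j.
Proof.
apply/funext => k; rewrite /pseries_diffs /expmx_coef exprmxS mulmxA mulrA.
by rewrite factS natrM invfM mulrA mulfV ?mul1r// pnatr_eq0.
Qed.

Lemma exprmxZ M s k : (s *: M) ^+ k = s ^+ k *: M ^+ k.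
Proof.
elim: k => [|k IH]; first by rewrite !expr0 scale1r.
by rewrite !exprmxS IH -scalemxAl -scalemxAr scalerA exprS.
Qed.

Let entry_sum M : R := \sum_i \sum_j `|M i j|.

Let entry_sum_ge0 M : 0 <= entry_sum M.
Proof. by apply: sumr_ge0 => i _; exact: sumr_ge0. Qed.

Let le_entry_sum M i j : `|M i j| <= entry_sum M.
Proof.
rewrite /entry_sum (bigD1 i)//= (bigD1 j)//= -addrA lerDl addr_ge0//.
  exact: sumr_ge0.
by apply: sumr_ge0 => ? _; exact: sumr_ge0.
Qed.

Let entry_mulX_bound N M k i j :
  `|(N *m M ^+ k) i j| <= entry_sum N * entry_sum M ^+ k.
Proof.
elim: k i j => [|k IH] i j; first by rewrite expr0 mulr1 mulmx1 le_entry_sum.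
rewrite exprmxSr mulmxA mxE (le_trans (ler_norm_sum _ _ _))//.
rewrite exprSr mulrA.
apply: (@le_trans _ _ (\sum_l (entry_sum N * entry_sum M ^+ k) * `|M l j|)).
  by apply: ler_sum => l _; rewrite normrM ler_wpM2r.
rewrite -mulr_sumr ler_wpM2l ?mulr_ge0 ?exprn_ge0//.
apply: ler_sum => l _; rewrite (bigD1 j)//= lerDl; exact: sumr_ge0.
Qed.

(** [entry_sum] bounds every entry and grows at most geometrically under powers, so a scalar
    exponential series dominates. *)
Lemma is_cvg_expmx_coef N M i j s : cvgn (pseries (expmx_coef N M i j) s).
Proof.
apply: normed_cvg.
pose v k : R := entry_sum N * exp_coeff (entry_sum M * `|s|) k.
apply: (@series_le_cvg _ _ v) => //.
- by move=> k; rewrite /= normr_ge0.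
- by move=> k; rewrite mulr_ge0 ?exp_coeff_ge0 ?mulr_ge0.
- move=> k /=; rewrite /v /exp_coeff /= /expmx_coef !normrM ger0_norm ?invr_ge0//.
  rewrite normrX exprMn -mulrA mulrC.
  have -> : entry_sum N * (entry_sum M ^+ k * `|s| ^+ k / k`!%:R) =
     entry_sum N * entry_sum M ^+ k * `|s| ^+ k / k`!%:R by ring.
  by rewrite !ler_wpM2r ?invr_ge0 ?exprn_ge0.
- rewrite (_ : series v = (fun k => entry_sum N * series (exp_coeff (entry_sum M * `|s|)) k)).
    exact: (cvgP _ (cvgM (cvg_cst _) (is_cvg_series_exp_coeff _))).
  by apply/funext => k; rewrite /series/= mulr_sumr.
Qed.

Definition expmx_entry N M i j s : R := limn (pseries (expmx_coef N M i j) s).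

Lemma cvg_expmx_entry N M i j s :
  pseries (expmx_coef N M i j) s k @[k --> \oo] --> expmx_entry N M i j s.
Proof. exact: is_cvg_expmx_coef. Qed.

Lemma expmxE M s : expmx (s *: M) = \matrix_(i, j) expmx_entry 1%:M M i j s.
Proof.
apply: cvg_lim; first exact: norm_hausdorff.
apply: cvg_mx => i j; rewrite mxE.
rewrite (_ : (fun k => _) = pseries (expmx_coef 1%:M M i j) s).
  exact: cvg_expmx_entry.
apply/funext => k; rewrite /series /pseries/= summxE.
by apply: eq_bigr => l _; rewrite exprmxZ !mxE /expmx_coef mul1mx mulrCA mulrC.
Qed.

Lemma expmx_entryE N M i j s : expmx_entry N M i j s = (N *m expmx (s *: M)) i j.
Proof.
apply/(cvg_lim (@Rhausdorff R)).
rewrite expmxE mxE.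
have h : (\sum_l N i l * pseries (expmx_coef 1%:M M l j) s k) @[k --> \oo] -->
    \sum_l N i l * expmx_entry 1%:M M l j s.
  apply: cvg_sum_seq => l; apply: cvgM; first exact: cvg_cst.
  exact: cvg_expmx_entry.
under [X in _ --> X]eq_bigr do rewrite mxE.
apply: cvg_trans h; apply: near_eq_cvg; apply: nearW => k.
rewrite /pseries /series/=; under eq_bigr do rewrite mulr_sumr.
rewrite exchange_big/=; apply: eq_bigr => l _.
rewrite /expmx_coef mxE mulr_sumr mulr_suml; apply: eq_bigr => p _.
by rewrite mul1mx; ring.
Qed.

Lemma is_derive_expmx_entry N M i j s :
  is_derive s (1 : R) (fun s => (N *m expmx (s *: M)) i j)
    ((N *m M *m expmx (s *: M)) i j).
Proof.
rewrite -expmx_entryE.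
under eq_fun do rewrite -expmx_entryE.
rewrite /expmx_entry -pseries_diffs_expmx_coef.
apply: (@pseries_snd_diffs _ _ (`|s| + 1)).
- exact: is_cvg_expmx_coef.
- by rewrite pseries_diffs_expmx_coef; exact: is_cvg_expmx_coef.
- by rewrite !pseries_diffs_expmx_coef; exact: is_cvg_expmx_coef.
- by rewrite [ltRHS]ger0_norm ?ltrDl// addr_ge0.
Qed.

Lemma expmx0 M : expmx (0 *: M) = 1%:M.
Proof.
apply/matrixP => i j; rewrite -[expmx _]mul1mx -expmx_entryE.
apply/(cvg_lim (@Rhausdorff R)).
apply: (@cvg_trans _ ((fun=> (1%:M : 'M[R]_n) i j) @ \oo)); last exact: cvg_cst.
apply: near_eq_cvg; near=> k.
have k0 : (0 < k)%N by near: k; exact: nbhs_infty_gt.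
rewrite -(prednK k0) /pseries /series/= big_nat_recl//= big1 => [|l _].
  by rewrite addr0 /expmx_coef expr0 mulr1 mulmx1 invr1 mul1r.
by rewrite expr0n mulr0.
Unshelve. all: by end_near. Qed.

Lemma comm_expmx M N s : N *m M = M *m N ->
  N *m expmx (s *: M) = expmx (s *: M) *m N.
Proof.
move=> NM; have NMk k : N *m M ^+ k = M ^+ k *m N.
  elim: k => [|k IH]; first by rewrite expr0 mulmx1 mul1mx.
  by rewrite exprmxSr mulmxA IH -!mulmxA NM.
apply/matrixP => i j; rewrite -expmx_entryE.
apply/(cvg_lim (@Rhausdorff R)).
rewrite expmxE mxE.
have h : (\sum_l pseries (expmx_coef 1%:M M i l) s k * N l j) @[k --> \oo] -->
    \sum_l expmx_entry 1%:M M i l s * N l j.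
  apply: cvg_sum_seq => l; apply: cvgM; last exact: cvg_cst.
  exact: cvg_expmx_entry.
under [X in _ --> X]eq_bigr do rewrite mxE.
apply: cvg_trans h; apply: near_eq_cvg; apply: nearW => k.
rewrite /pseries /series/=; under eq_bigr do rewrite mulr_suml.
rewrite exchange_big/=; apply: eq_bigr => l _.
rewrite /expmx_coef NMk mxE mulr_sumr mulr_suml; apply: eq_bigr => p _.
by rewrite mul1mx; ring.
Qed.

Lemma trmx_expmx M s : (expmx (s *: M))^T = expmx (s *: M^T).
Proof.
have tX k : (M^T) ^+ k = (M ^+ k)^T.
  elim: k => [|k IH]; first by rewrite !expr0 trmx1.
  by rewrite exprmxS exprmxSr trmx_mul IH.
apply/matrixP => i j; rewrite !expmxE !mxE /expmx_entry; congr (lim (_ @ \oo)).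
apply/funext => k; rewrite /pseries /series/=; apply: eq_bigr => l _.
by rewrite /expmx_coef !mul1mx tX mxE.
Qed.

End matrix_exponential.

Section derivative_of_matrices.
Context {R : realType}.

Definition is_derive_mx m n (E : R -> 'M[R]_(m, n)) (s : R) (dE : 'M[R]_(m, n)) :=
  forall i j, is_derive s (1 : R) (fun s => E s i j) (dE i j).

Lemma is_derive_fun_sum (I : Type) (r : seq I) (f : I -> R -> R) (df : I -> R) s :
  (forall i, is_derive s (1 : R) (f i) (df i)) ->
  is_derive s (1 : R) (fun s => \sum_(i <- r) f i s) (\sum_(i <- r) df i).
Proof.
move=> fdf; elim: r => [|i r IH].
  rewrite big_nil; under eq_fun do rewrite big_nil.
  exact: is_derive_fun_cst.
rewrite big_cons; under eq_fun do rewrite big_cons.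
exact: is_derive_funD.
Qed.

Lemma is_derive_mx_cst m n (M : 'M[R]_(m, n)) s : is_derive_mx (fun=> M) s 0.
Proof. by move=> i j; rewrite mxE; exact: is_derive_fun_cst. Qed.

Lemma is_derive_mulmx m n p (E : R -> 'M[R]_(m, n)) (F : R -> 'M[R]_(n, p))
    s dE dF : is_derive_mx E s dE -> is_derive_mx F s dF ->
  is_derive_mx (fun s => E s *m F s) s (dE *m F s + E s *m dF).
Proof.
move=> hE hF i j; under eq_fun do rewrite mxE.
rewrite !mxE -big_split/=.
by apply: is_derive_fun_sum => l; exact: is_derive_funM.
Qed.

Lemma is_derive_inner n (u w : 'cV[R]_n) (E : R -> 'M[R]_n) s dE :
  is_derive_mx E s dE ->
  is_derive s (1 : R) (fun s => inner u (E s *m w)) (inner u (dE *m w)).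
Proof.
move=> hE; rewrite innerE; under eq_fun do rewrite innerE.
have h := is_derive_mulmx (is_derive_mx_cst u^T s)
  (is_derive_mulmx hE (is_derive_mx_cst w s)).
by have := h 0 0; rewrite mul0mx add0r mulmx0 addr0.
Qed.

Lemma is_derive_expmx n (M : 'M[R]_n) s :
  is_derive_mx (fun s => expmx (s *: M)) s (M *m expmx (s *: M)).
Proof.
move=> i j; have := is_derive_expmx_entry 1%:M M i j s.
by rewrite mul1mx; under eq_fun do rewrite mul1mx.
Qed.

Lemma exponential_ode (f : R -> R) (c : R) :
  (forall s, is_derive s (1 : R) f (c * f s)) ->
  forall s, f s = expR (c * s) * f 0.
Proof.
move=> fd s; pose F s := f s * expR (- (c * s)).
have dF t : is_derive t (1 : R) F 0.
  have h := is_derive_funM (fd t) (is_derive_fun_comp (is_derive_expR _)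
    (is_derive_funN (is_derive_funZ c (is_derive_fun_id t)))).
  by apply: (is_derive_eq h); ring.
have := is_derive_0_is_cst s 0 dF.
rewrite /F mulr0 oppr0 expR0 mulr1 => <-.
by rewrite mulrCA -expRD subrr expR0 mulr1.
Qed.

End derivative_of_matrices.

(** * Normal matrices in the eigenbasis of the symmetric part *)

Section orthonormal_basis.
Context {R : realType} {n : nat}.
Variable v : 'I_n -> 'cV[R]_n.
Hypothesis hv : orthonormal_family v.

Definition basis_mx : 'M[R]_n := \matrix_(i, l) v l i 0.

Lemma basis_mx_orthogonal : basis_mx *m basis_mx^T = 1%:M.
Proof.
apply: mulmx1C; apply/matrixP => k l; rewrite !mxE -(hv k l) /inner.
by apply: eq_bigr => i _; rewrite !mxE.
Qed.

Lemma basis_mx_tr_mul u : basis_mx^T *m u = \col_l inner (v l) u.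
Proof.
apply/matrixP => l k; rewrite ord1 !mxE.
by apply: eq_bigr => i _; rewrite !mxE.
Qed.

Lemma parseval (u w : 'cV[R]_n) :
  inner u w = \sum_l inner (v l) u * inner (v l) w.
Proof.
rewrite -[w in LHS]mul1mx -basis_mx_orthogonal -mulmxA inner_mulmx.
rewrite !basis_mx_tr_mul; by apply: eq_bigr => l _; rewrite !mxE.
Qed.

Definition spectral_mx (k : 'I_n -> R) : 'M[R]_n :=
  basis_mx *m diag_mx (\row_l k l) *m basis_mx^T.

Lemma inner_spectral_mx k l (u : 'cV[R]_n) :
  inner (v l) (spectral_mx k *m u) = k l * inner (v l) u.
Proof.
have e (w : 'cV[R]_n) : inner (v l) w = (basis_mx^T *m w) l 0.
  by rewrite basis_mx_tr_mul mxE.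
rewrite !e /spectral_mx !mulmxA.
by rewrite (mulmx1C basis_mx_orthogonal) mul1mx -mulmxA mul_diag_mx !mxE.
Qed.

Lemma tr_spectral_mx k : (spectral_mx k)^T = spectral_mx k.
Proof. by rewrite /spectral_mx !trmx_mul trmxK tr_diag_mx mulmxA. Qed.

End orthonormal_basis.

Section normal_matrix.
Context {R : realType} {n : nat}.
Variables (A : 'M[R]_n) (phi : 'I_n -> R) (v : 'I_n -> 'cV[R]_n).
Hypothesis hA : A *m A^T = A^T *m A.
Hypothesis hv : orthonormal_family v.
Hypothesis heig : forall j, (A + A^T) *m v j = phi j *: v j.

Let expN (B : 'M[R]_n) (s : R) : expmx (- s *: B) = expmx (s *: - B).
Proof. by rewrite scaleNr scalerN. Qed.

Lemma tr_expmxN s : (expmx (- s *: A))^T = expmx (- s *: A^T).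
Proof. by rewrite trmx_expmx. Qed.

Lemma expmxN_normal s :
  expmx (- s *: A^T) *m expmx (- s *: A) = expmx (- s *: A) *m expmx (- s *: A^T).
Proof.
apply: comm_expmx; apply/esym/comm_expmx.
by rewrite hA.
Qed.

(** Because A and A^T commute, W(s) = e^{-sA} e^{-sA^T} solves W' = - (A + A^T) W. Testing against
    the eigenvector [v l] of the symmetric matrix A + A^T leaves the scalar equation f' = - phi_l
    f. *)
Lemma inner_expmx_gram l s (w : 'cV[R]_n) :
  inner (v l) (expmx (- s *: A) *m expmx (- s *: A^T) *m w) =
  expR (- (phi l * s)) * inner (v l) w.
Proof.
pose W s := expmx (s *: - A) *m expmx (s *: - A^T).
have dW t : is_derive_mx W t (- ((A + A^T) *m W t)).
  have h := is_derive_mulmx (is_derive_expmx (- A) t) (is_derive_expmx (- A^T) t).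
  suff <- : - A *m expmx (t *: - A) *m expmx (t *: - A^T) +
    expmx (t *: - A) *m (- A^T *m expmx (t *: - A^T)) = - ((A + A^T) *m W t) by [].
  have c : - A^T *m expmx (t *: - A) = expmx (t *: - A) *m - A^T.
    by apply: comm_expmx; rewrite !mulmxN !mulNmx !opprK hA.
  by rewrite /W mulmxA -c -!mulmxA !mulNmx -opprD mulmxDl.
pose f t := inner (v l) (W t *m w).
have fd t : is_derive t (1 : R) f (- phi l * f t).
  have h := is_derive_inner (v l) w (dW t).
  apply: (is_derive_eq h).
  rewrite mulNmx innerNr mulNr; congr (- _).
  rewrite -mulmxA inner_mulmx linearD/= trmxK addrC heig.
  by rewrite innerZl.
have := exponential_ode fd s.
rewrite /f /W !expmx0 mulmx1 mul1mx mulNr => <-.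
by rewrite !expN.
Qed.

Lemma inner_expmx_gram_sum s (u : 'cV[R]_n) :
  inner (expmx (- s *: A^T) *m u) (expmx (- s *: A^T) *m u) =
  \sum_l expR (- (phi l * s)) * inner (v l) u ^+ 2.
Proof.
rewrite inner_mulmx -tr_expmxN trmxK mulmxA tr_expmxN innerC (parseval hv).
by apply: eq_bigr => l _; rewrite inner_expmx_gram expr2 mulrCA.
Qed.

(** Here the factors of the Gram matrix come in the opposite order, and normality exchanges them. *)
Lemma sqnorm_expmx s (x : 'cV[R]_n) :
  sqnorm (expmx (- s *: A) *m x) = \sum_l expR (- (phi l * s)) * inner (v l) x ^+ 2.
Proof.
rewrite /sqnorm inner_mulmx tr_expmxN mulmxA expmxN_normal innerC (parseval hv).
by apply: eq_bigr => l _; rewrite inner_expmx_gram expr2 mulrCA.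
Qed.

End normal_matrix.

(** * Stationary covariance *)

Section integrals.
Context {R : realType}.
Local Notation leb := (@lebesgue_measure R).

Lemma integral_expRN (c : R) : 0 < c ->
  (\int[leb]_(s in `[0%R, +oo[) (expR (- (c * s)))%:E = (c^-1)%:E)%E.
Proof.
move=> c0.
have dF (s : R) : is_derive s (1 : R) (fun s => - c^-1 * expR (- (c * s))) (expR (- (c * s))).
  have h := is_derive_funZ (- c^-1) (is_derive_fun_comp (is_derive_expR _)
    (is_derive_funN (is_derive_funZ c (is_derive_fun_id s)))).
  by apply: (is_derive_eq h); field; rewrite gt_eqF.
have df (s : R) : is_derive s (1 : R) (fun s => expR (- (c * s)))
    (expR (- (c * s)) * (- (c * 1))).
  exact: is_derive_fun_comp (is_derive_expR _)
    (is_derive_funN (is_derive_funZ c (is_derive_fun_id s))).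
rewrite (@ge0_continuous_FTC2y R _ (fun s => - c^-1 * expR (- (c * s))) 0 0).
- by rewrite mulr0 oppr0 expR0 mulr1 sub0e -EFinN opprK.
- by move=> s _; exact: expR_ge0.
- by apply: continuous_subspaceT => s; exact: is_derive_continuous (df s).
- rewrite -[X in _ --> X](mulr0 (- c^-1)); apply: cvgM; first exact: cvg_cst.
  apply: (@cvg_comp _ _ _ (fun s => c * s) (fun s => expR (- s)) _ +oo _).
    by apply: gt0_cvgMry => //; exact: cvg_id.
  exact: cvgr_expR.
- by move=> s _; have [] := dF s.
- by apply: cvg_at_right_filter; exact: is_derive_continuous (dF 0).
- by move=> s _; rewrite derive1E; have [_ ->] := dF s.
Qed.

Lemma integrable_expRN (c : R) : 0 < c ->
  leb.-integrable `[0, +oo[ (fun s => (expR (- (c * s)))%:E).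
Proof.
move=> c0; apply/integrableP; split.
  apply/measurable_EFinP; apply: measurable_funTS.
  apply: measurableT_comp; first exact: measurable_expR.
  by under eq_fun do rewrite -mulNr; exact: measurable_funM.
under eq_integral do rewrite gee0_abs ?lee_fin ?expR_ge0//.
by rewrite integral_expRN// ltry.
Qed.

Lemma Rintegral_fun_sum d (T : measurableType d) (mu : {measure set T -> \bar R})
    (D : set T) (I : Type) (r : seq I) (f : I -> T -> R) : measurable D ->
  (forall i, mu.-integrable D (EFin \o f i)) ->
  mu.-integrable D (fun x => (\sum_(i <- r) f i x)%:E) /\
  \int[mu]_(x in D) (\sum_(i <- r) f i x) = \sum_(i <- r) \int[mu]_(x in D) f i x.
Proof.
move=> mD fi; elim: r => [|i r [IHi IH]].
  rewrite big_nil; under eq_fun do rewrite big_nil; split; first exact: integrable0.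
  under eq_Rintegral do rewrite big_nil.
  by rewrite Rintegral_cst// mul0r.
rewrite big_cons; under eq_fun do rewrite big_cons.
under eq_Rintegral do rewrite big_cons.
split.
  by apply: eq_integrable (integrableD mD (fi i) IHi).
by rewrite -IH RintegralD.
Qed.

End integrals.

Section stationary_covariance.
Context {R : realType} {n : nat}.
Variables (A : 'M[R]_n) (phi : 'I_n -> R) (v : 'I_n -> 'cV[R]_n).
Hypothesis hA : A *m A^T = A^T *m A.
Hypothesis hv : orthonormal_family v.
Hypothesis heig : forall j, (A + A^T) *m v j = phi j *: v j.
Hypothesis phi_gt0 : forall j, 0 < phi j.

(** Expanding the integrand in the basis [v] separates the modes, each of which integrates to 1 /
    phi_l. *)
Lemma Sigma_inftyE i j : Sigma_infty A i j = \sum_l (phi l)^-1 * (v l i 0 * v l j 0).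
Proof.
rewrite mxE.
have e s : (expmx (- s *: A) *m expmx (- s *: A^T)) i j =
    \sum_l (v l i 0 * v l j 0) * expR (- (phi l * s)).
  transitivity (inner (delta_mx i 0)
     (expmx (- s *: A) *m expmx (- s *: A^T) *m (delta_mx j 0 : 'cV[R]_n))).
    by rewrite inner_delta -colE [RHS]mxE.
  rewrite (parseval hv); apply: eq_bigr => l _.
  rewrite (inner_expmx_gram hA heig) !(innerC (v l)) !inner_delta; ring.
under eq_Rintegral do rewrite e.
have ie l : (@lebesgue_measure R).-integrable `[0, +oo[
    (EFin \o fun s => (v l i 0 * v l j 0) * expR (- (phi l * s))).
  have h := integrable_expRN (phi_gt0 l).
  exact: (integrableZl _ (v l i 0 * v l j 0) h).
have [_ ->] := @Rintegral_fun_sum R _ _ (@lebesgue_measure R) _ _ (index_enum 'I_n) _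
  (measurable_itv _) ie.
apply: eq_bigr => l _; rewrite RintegralZl//; last exact: integrable_expRN.
by rewrite /Rintegral integral_expRN// mulrC.
Qed.

Lemma inner_Sigma_infty u :
  inner u (Sigma_infty A *m u) = \sum_l (phi l)^-1 * inner (v l) u ^+ 2.
Proof.
have -> : Sigma_infty A *m u = \sum_l ((phi l)^-1 * inner (v l) u) *: v l.
  apply/matrixP => i k; rewrite ord1 mxE summxE.
  under eq_bigr do rewrite Sigma_inftyE mulr_suml.
  rewrite exchange_big/=; apply: eq_bigr => l _.
  rewrite mxE mulr_sumr mulr_suml; apply: eq_bigr => p _; ring.
rewrite inner_sumr; apply: eq_bigr => l _.
by rewrite innerZr (innerC u) expr2 mulrA.
Qed.

End stationary_covariance.

(** * Pathwise variation of constants *)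

Section paths.
Context {R : realType}.
Local Notation leb := (@lebesgue_measure R).

(** Compactness of [0, T] turns joint continuity at diagonal points into a uniform modulus. It will
    control the difference of two values of Phi taken at distinct points of one grid cell. *)
Lemma near_diagonal_uniform (Phi : R -> R -> R) (T eps : R) : 0 < eps ->
  (forall x, Phi z.1 z.2 @[z --> (x, x)] --> Phi x x) ->
  exists2 delta, 0 < delta & forall x y z, 0 <= x <= T ->
    `|y - x| < delta -> `|z - x| < delta -> `|Phi y z - Phi x x| <= eps.
Proof.
move=> e0 cPhi.
pose P (delta x : R) := forall y z, `|y - x| < delta -> `|z - x| < delta ->
  `|Phi y z - Phi x x| <= eps.
have near_cov : near_covering `[0, T].
  by apply/compact_near_coveringP; exact: segment_compact.
have hloc x : `[0, T]%classic x -> \forall x' \near x & delta \near 0^'+, P delta x'.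
  move=> _.
  have [r r0 hr] : exists2 r, 0 < r & forall y z, `|x - y| < r -> `|x - z| < r ->
      `|Phi x x - Phi y z| < eps / 2.
    have e2 : 0 < eps / 2 by rewrite divr_gt0.
    have /cvgrPdist_lt /(_ _ e2) /nbhs_ballP [r r0 hr] := cPhi x.
    by exists r => // y z xy xz; apply: (hr (y, z)); split.
  have r2 : 0 < r / 2 by rewrite divr_gt0.
  exists (ball x (r / 2), [set d | d < r / 2]).
    by split => /=; [exact: nbhsx_ballx|exact: nbhs_right_lt].
  move=> [x' d] /= [xx' dr] y z yx zx.
  have xx2 : `|x - x'| < r / 2 by [].
  have yr : `|x - y| < r.
    have := ler_distD x' x y; rewrite (distrC x' y); lra.
  have zr : `|x - z| < r.
    have := ler_distD x' x z; rewrite (distrC x' z); lra.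
  have h1 := hr _ _ yr zr.
  have xr : `|x - x'| < r by lra.
  have h2 := hr _ _ xr xr.
  have := ler_distD (Phi x x) (Phi y z) (Phi x' x').
  rewrite (distrC (Phi y z) (Phi x x)); lra.
have h : \forall delta \near 0^'+, `[0, T] `<=` P delta by apply: near_cov hloc.
near ((0 : R)^'+) => delta.
have hd : `[0, T] `<=` P delta by near: delta.
by exists delta => // x y z x0T yx zx; apply: hd => //; rewrite /= in_itv.
Unshelve. all: by end_near. Qed.

(** Freezing the path at its initial value for negative times turns continuity on the half-line into
    continuity on the whole line. *)
Lemma continuous_extension n (f : R -> 'cV[R]_n) (i : 'I_n) :
  {within `[0, +oo[, continuous f} ->
  continuous (fun s : R => f (Num.max s 0) i ord0).
Proof.
move=> /subspace_continuousP cf s.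
apply: (@continuous_comp _ _ _ (fun s : R => f (Num.max s 0)) (fun M : 'cV[R]_n => M i ord0));
  last exact: coord_continuous.
have A0 (r : R) : `[0, +oo[%classic (Num.max r 0) by rewrite /= in_itv/= andbT le_max lexx orbT.
apply: cvg_comp (cf _ (A0 s)).
move=> B; rewrite /within /= => hB.
have cmax : Num.max r 0 @[r --> s] --> Num.max s 0.
  under eq_fun do rewrite maxr_absE.
  rewrite maxr_absE; apply: cvgM; last exact: cvg_cst.
  apply: cvgD; first by apply: cvgD; [exact: cvg_id|exact: cvg_cst].
  by apply: cvg_norm; apply: cvgB; [exact: cvg_id|exact: cvg_cst].
apply: (@filterS _ (nbhs s) _ _ _ _ (cmax _ hB)) => r hr; apply: hr => /=.
exact: A0.
Qed.

Lemma FTC_continuous (f : R -> R) : continuous f ->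
  (forall s : R, 0 < s -> is_derive s (1 : R) (fun s => \int[leb]_(r in `[0, s]) f r) (f s)) /\
  (forall T : R, 0 <= T -> {within `[0, T], continuous (fun s => \int[leb]_(r in `[0, s]) f r)}).
Proof.
move=> cf; have intf T : leb.-integrable `[0, T] (EFin \o f).
  apply: continuous_compact_integrable; first exact: segment_compact.
  exact: continuous_subspaceT.
split=> [s s0|T T0].
  have s1 : s < s + 1 by rewrite ltrDl.
  have [df fE] := continuous_FTC1_closed s1 (intf _) s0 (cf s).
  by apply: (DeriveDef df); rewrite -derive1E; exact: fE.
exact: parameterized_integral_continuous.
Qed.

End paths.

Section variation_of_constants.
Context {R : realType} {m n : nat}.
Local Notation leb := (@lebesgue_measure R).
Variables (A : 'M[R]_m) (sigma : 'M[R]_(m, n)) (x : 'cV[R]_m).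
Variables (X : R -> 'cV[R]_m) (L : R -> 'cV[R]_n).
Hypothesis cX : {within `[0, +oo[, continuous X}.
Hypothesis cL : {within `[0, +oo[, continuous L}.
Hypothesis L0 : L 0 = 0.
Hypothesis eqX : forall t, 0 <= t ->
  X t = x + \col_i (\int[leb]_(s in `[0, t]) (- (A *m X s)) i 0) + sigma *m L t.
Variables (T : R) (u : 'cV[R]_m).
Hypothesis T0 : 0 < T.

(** The propagator e^{-(T-y)A} from time y to the final time T. *)
Let E y := expmx ((y - T) *: A).

Let dE y : is_derive_mx E y (A *m E y).
Proof.
move=> i j.
have h := @is_derive_fun_comp _ (fun s => expmx (s *: A) i j) (fun y => y - T) y _ _
  (is_derive_expmx A (y - T) i j)
  (is_derive_funD (is_derive_fun_id y) (is_derive_fun_cst (- T) y)).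
by apply: (is_derive_eq h); ring.
Qed.

Let AE y : A *m E y = E y *m A. Proof. exact: comm_expmx. Qed.

Let Xt s := X (Num.max s 0).
Let Lt s := L (Num.max s 0).

Let XtE (s : R) : 0 <= s -> Xt s = X s.
Proof. by move=> s0; rewrite /Xt; congr X; apply/max_idPl. Qed.

Let LtE (s : R) : 0 <= s -> Lt s = L s.
Proof. by move=> s0; rewrite /Lt; congr L; apply/max_idPl. Qed.

Let row y : 'rV[R]_m := u^T *m E y.

Let is_derive_row y k : is_derive y (1 : R) (fun y => row y 0 k) ((row y *m A) 0 k).
Proof.
have h := is_derive_mulmx (is_derive_mx_cst u^T y) (dE y).
have := h 0 k; rewrite mul0mx add0r.
by rewrite AE mulmxA.
Qed.

Let continuous_row k : continuous (fun y => row y 0 k).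
Proof. by move=> y; exact: is_derive_continuous (is_derive_row y k). Qed.

Let inner_row y (w : 'cV[R]_m) : inner u (E y *m w) = \sum_k row y 0 k * w k 0.
Proof. by rewrite innerE mulmxA mxE. Qed.

Let continuous_mulmx_coord p q (M : 'M[R]_(p, q)) (f : R -> 'cV[R]_q) k :
  (forall i, continuous (fun s => f s i 0)) -> continuous (fun s => (M *m f s) k 0).
Proof.
move=> cf; rewrite (_ : (fun s => _) = fun s => \sum_i M k i * f s i 0); last first.
  by apply/funext => s; rewrite mxE.
by move=> s; apply: cvg_sum_seq => i; apply: cvgM; [exact: cvg_cst|exact: cf].
Qed.

(** The time y of the propagator and the time z of the noise are kept apart because the mean value
    theorem evaluates them at different points. *)
Let Phi y z : R := inner u (E y *m (A *m sigma *m Lt z)).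

Let continuous_Phi s : Phi z.1 z.2 @[z --> (s, s)] --> Phi s s.
Proof.
rewrite /Phi inner_row; under eq_fun do rewrite inner_row.
apply: cvg_sum_seq => k; apply: cvgM.
  by apply: (@cvg_comp _ _ _ (fun z : R * R => z.1) (fun y => row y 0 k) _ (nbhs s));
    [exact: cvg_fst|exact: continuous_row].
apply: (@cvg_comp _ _ _ (fun z : R * R => z.2) (fun z => (A *m sigma *m Lt z) k 0) _ (nbhs s)).
  exact: cvg_snd.
apply: continuous_mulmx_coord => i; exact: continuous_extension.
Qed.

Let f i s : R := (- (A *m Xt s)) i 0.

Let continuous_f i : continuous (f i).
Proof.
rewrite (_ : f i = fun s => ((- A) *m Xt s) i 0); last first.
  by apply/funext => s; rewrite mulNmx.
apply: continuous_mulmx_coord => j; exact: continuous_extension.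
Qed.

(* As the noise is additive, G = X - sigma L is C^1 along the path. *)
Let G s : 'cV[R]_m := x + \col_i (\int[leb]_(r in `[0, s]) f i r).

Let GE s : 0 <= s -> G s = Xt s - sigma *m Lt s.
Proof.
move=> s0; rewrite XtE// LtE// eqX// addrK; congr (_ + _).
apply/matrixP => i j; rewrite !mxE; apply: eq_Rintegral => r.
rewrite inE/= in_itv/= => /andP[r0 _].
by rewrite /f XtE.
Qed.

Let H s := inner u (E s *m G s).

Let HE : H = fun s => \sum_k row s 0 k * G s k 0.
Proof. by apply/funext => s; rewrite /H inner_row. Qed.

(** Since G' = - A X, the two terms of the product rule combine to <u, E A (G - X)>, and G - X = -
    sigma L. *)
Let is_derive_H (s : R) : 0 < s -> is_derive s (1 : R) H (- Phi s s).
Proof.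
move=> s0.
have dG k : is_derive s (1 : R) (fun s => G s k 0) (f k s).
  under eq_fun do rewrite /G !mxE.
  have [dF _] := FTC_continuous (@continuous_f k).
  have h := is_derive_funD (is_derive_fun_cst (x k 0) s) (dF s s0).
  by apply: (is_derive_eq h); rewrite add0r.
have h := is_derive_fun_sum (index_enum 'I_m)
  (fun k => is_derive_funM (is_derive_row s k) (dG k)).
rewrite HE.
apply: (is_derive_eq h); rewrite big_split/=.
have -> : \sum_k (row s *m A) 0 k * G s k 0 = inner u (E s *m (A *m G s)).
  by rewrite innerE !mulmxA mxE.
have -> : \sum_k row s 0 k * f k s = inner u (E s *m (- (A *m Xt s))).
  by rewrite inner_row.
rewrite -innerDr -mulmxDr -mulmxBr GE ?(ltW s0)// addrAC subrr add0r.
by rewrite /Phi !mulmxN innerNr !mulmxA.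
Qed.

Let continuous_H p q : 0 <= p -> p <= q -> {within `[p, q], continuous H}.
Proof.
move=> p0 pq; apply: (@continuous_subspaceW _ _ _ `[0, q]).
  by apply: subset_itvr; rewrite bnd_simp.
rewrite HE.
move=> s; rewrite /continuous_at; apply: cvg_sum_seq => k; apply: cvgM.
  by apply: (@continuous_subspaceT _ _ `[0, q]%classic (fun y => row y 0 k)); exact: continuous_row.
have [_ cF] := FTC_continuous (@continuous_f k).
have : {within `[0, q], continuous (fun s => G s k 0)}.
  rewrite (_ : (fun s => _) = fun s => x k 0 + \int[leb]_(r in `[0, s]) f k r).
    by move=> t; apply: cvgD; [exact: cvg_cst|exact: cF (le_trans p0 pq) t].
  by apply/funext => t; rewrite !mxE.
exact.
Qed.

Let K s := inner u (E s *m Xt s).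

(* On each cell of the grid the mean value theorem, applied to H and to
   s |-> <u, E s sigma L_q>, replaces the Ito formula. *)
Let cell p q : 0 <= p -> p < q -> exists xi xi', [/\ p <= xi <= q, p <= xi' <= q &
  inner u (E p *m (sigma *m (Lt q - Lt p))) - (K q - K p) =
  (q - p) * (Phi xi' xi' - Phi xi q)].
Proof.
move=> p0 pq.
have [|xi' xi'pq eH] := @MVT_segment R H (fun s => - Phi s s) p q (ltW pq) _
    (continuous_H p0 (ltW pq)).
  move=> s; rewrite in_itv/= => /andP[ps _].
  by apply: is_derive_H; exact: le_lt_trans ps.
pose w := sigma *m Lt q.
have dw s : is_derive s (1 : R) (fun s => inner u (E s *m w)) (Phi s q).
  have h := is_derive_inner u w (dE s).
  by apply: (is_derive_eq h); rewrite AE /Phi /w !mulmxA.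
have [|xi xipq ew] := @MVT_segment R (fun s => inner u (E s *m w)) (fun s => Phi s q) p q (ltW pq)
    (fun s _ => dw s).
  by apply: continuous_subspaceT => s; exact: is_derive_continuous (dw s).
exists xi, xi'; move: xi'pq xipq; rewrite !in_itv/= => -> ->; split=> //.
have q0 := le_trans p0 (ltW pq).
(* As K = H + <u, E sigma L>, the left-hand side is minus the increment of H minus the increment of
   s |-> <u, E s sigma L_q>. *)
rewrite mulrBr -(mulrC (Phi xi q)) -ew -[(q - p) * _]opprK -mulrN (mulrC (q - p)) -eH.
rewrite /H !GE// /K /w !mulmxBr !innerDr !innerNr.
move: (inner u (E q *m Xt q)) (inner u (E p *m Xt p)) => a b.
move: (inner u (E q *m (sigma *m Lt q))) (inner u (E p *m (sigma *m Lt q))) => c d.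
move: (inner u (E p *m (sigma *m Lt p))) => e.
ring.
Qed.

Let grid k j : R := j%:R * (T / k.+1%:R).

(** Summed over the grid, the increments of K in [cell] telescope to the right-hand side. Each of
    the k + 1 cells errs by at most its length times eps / T, hence by eps in total. *)
Lemma cvg_variation_of_constants :
  \sum_(j < k.+1) inner u (expmx (- (T - grid k j) *: A) *m
     (sigma *m (L (grid k j.+1) - L (grid k j)))) @[k --> \oo] -->
  inner u (X T) - inner u (expmx (- T *: A) *m x).
Proof.
have grid0 k j : 0 <= grid k j.
  by rewrite /grid !mulr_ge0// ?(ltW T0)// invr_ge0.
have gridS k j : grid k j.+1 - grid k j = T / k.+1%:R.
  by rewrite /grid -mulrBl -natrB// subSnn mul1r.
have h0 k : 0 < T / k.+1%:R by rewrite divr_gt0.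
have gridT k : grid k k.+1 = T by rewrite /grid mulrC divfK// pnatr_eq0.
have gridle k j : (j <= k.+1)%N -> grid k j <= T.
  by move=> jk; rewrite -(gridT k) ler_wpM2r ?(ltW (h0 k))// ler_nat.
have KT : K T = inner u (X T).
  by rewrite /K /E subrr expmx0 mul1mx XtE// ltW.
have K0 : K 0 = inner u (expmx (- T *: A) *m x).
  rewrite /K /E sub0r XtE// eqX// L0 mulmx0 addr0; congr (inner u (_ *m _)).
  apply/matrixP => i j; rewrite !mxE set_itv1 Rintegral_set1 addr0.
  by rewrite ord1.
rewrite -KT -K0; apply/cvgrPdist_le => eps e0.
have eT : 0 < eps / T by rewrite divr_gt0.
have [delta d0 hd] := near_diagonal_uniform T eT continuous_Phi.
near=> k.
have hk : T / k.+1%:R < delta.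
  rewrite ltr_pdivrMr ?ltr0n// mulrC -ltr_pdivrMr//.
  rewrite (lt_le_trans (truncnS_gt _))// ler_nat ltnS.
  near: k; exact: nbhs_infty_ge.
rewrite distrC.
have -> : K T - K 0 = \sum_(j < k.+1) (K (grid k j.+1) - K (grid k j)).
  rewrite -(big_mkord xpredT (fun j => K (grid k j.+1) - K (grid k j))).
  by rewrite telescope_sumr// gridT /grid mul0r.
rewrite -sumrB; apply: le_trans (ler_norm_sum _ _ _) _.
apply: (@le_trans _ _ (\sum_(j < k.+1) T / k.+1%:R * (eps / T))); last first.
  rewrite sumr_const card_ord -mulr_natr.
  by rewrite le_eqVlt; apply/orP; left; apply/eqP; field; rewrite gt_eqF//= pnatr_eq0.
apply: ler_sum => j _.
have pq : grid k j < grid k j.+1 by rewrite -subr_gt0 gridS.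
have [xi [xi' [hxi hxi' e]]] := cell (grid0 k j) pq.
have -> : inner u (expmx (- (T - grid k j) *: A) *m
    (sigma *m (L (grid k j.+1) - L (grid k j)))) -
  (K (grid k j.+1) - K (grid k j)) = T / k.+1%:R * (Phi xi' xi' - Phi xi (grid k j.+1)).
  by rewrite -(gridS k j) -e /E opprB !LtE.
rewrite normrM (ger0_norm (ltW (h0 k))) ler_wpM2l ?(ltW (h0 k))// distrC.
move/andP: hxi => [hxi1 hxi2]; move/andP: hxi' => [hxi'1 hxi'2].
move: hk; rewrite -(gridS k j) => hk.
have := hd xi' xi (grid k j.+1); apply.
- by rewrite (le_trans (grid0 k j))//= (le_trans hxi'2)// gridle.
- by rewrite ltr_norml; apply/andP; split; lra.
- by rewrite ltr_norml; apply/andP; split; lra.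
Unshelve. all: by end_near. Qed.

End variation_of_constants.

Section riemann_exponential.
Context {R : realType}.

Lemma sub1_expRN (y : R) : 0 <= 1 - expR (- y) <-> 0 <= y.
Proof. by rewrite subr_ge0 -expR0 ler_expR oppr_le0. Qed.

(** With step h the sum is geometric, equal to q (1 - e^{-cT}) for q = h / (e^{ch} - 1), and q lies
    between e^{-ch} / c and 1 / c. *)
Lemma cvg_exponential_sum (c T : R) : 0 < c -> 0 < T ->
  \sum_(j < k.+1) T / k.+1%:R * expR (- (c * (T - j%:R * (T / k.+1%:R))))
    @[k --> \oo] --> c^-1 * (1 - expR (- (c * T))).
Proof.
move=> c0 T0.
pose h k : R := T / k.+1%:R.
have h0 k : 0 < h k by rewrite divr_gt0.
pose q k : R := h k / (expR (c * h k) - 1).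
have e1 k : 0 < expR (c * h k) - 1 by rewrite subr_gt0 -expR0 ltr_expR mulr_gt0.
have sumE k : \sum_(j < k.+1) h k * expR (- (c * (T - j%:R * h k))) =
    q k * (1 - expR (- (c * T))).
  pose g j : R := expR (- (c * (T - j%:R * h k))).
  have gS j : h k * g j = q k * (g j.+1 - g j).
    have -> : g j.+1 = expR (c * h k) * g j.
      by rewrite /g -expRD -natr1; congr expR; ring.
    by rewrite /q -[X in _ * (_ - X)]mul1r -mulrBl mulrA divfK// gt_eqF.
  have -> : \sum_(j < k.+1) h k * g j = \sum_(j < k.+1) q k * (g j.+1 - g j).
    by apply: eq_bigr => j _; rewrite gS.
  rewrite -mulr_sumr -(big_mkord xpredT (fun j => g j.+1 - g j)) telescope_sumr//.
  rewrite /g /h mulrC (mulrC _ (T / _)) divfK ?pnatr_eq0// subrr mulr0 oppr0 expR0.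
  by rewrite mul0r subr0 mulrC.
rewrite (_ : (fun k => _) = fun k => q k * (1 - expR (- (c * T)))); last first.
  by apply/funext => k; rewrite -sumE.
apply: cvgM; last exact: cvg_cst.
have ch : h k @[k --> \oo] --> (0 : R).
  rewrite -[X in _ --> X](mulr0 T); apply: cvgM; first exact: cvg_cst.
  exact: cvg_harmonic.
have ce : expR (- (c * h k)) @[k --> \oo] --> (1 : R).
  rewrite -[X in _ --> X]expR0 -[X in expR X]oppr0 -[X in expR (- X)](mulr0 c).
  apply: (@cvg_comp _ _ _ (fun k => - (c * h k)) expR _ (nbhs (- (c * 0)))).
    by apply: cvgN; apply: cvgM => //; exact: cvg_cst.
  exact: continuous_expR.
apply: (@squeeze_cvgr _ _ _ _ (fun k => c^-1 * expR (- (c * h k))) (cst c^-1)).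
- near=> k; set y := c * h k.
  have y0 : 0 < y by rewrite mulr_gt0.
  have u1 := expR_ge1Dx y.
  have u2 := expR_ge1Dx (- y).
  have ey : 0 < expR y - 1 := e1 k.
  have eyp : 0 < expR y by exact: expR_gt0.
  have hk : h k = y / c by rewrite /y mulrC mulKf// gt_eqF.
  rewrite /q -/y hk; apply/andP; split.
    have ee : expR y * expR (- y) = 1 by rewrite -expRD subrr expR0.
    rewrite ler_pdivlMr//.
    have -> : c^-1 * expR (- y) * (expR y - 1) = c^-1 * (expR y * expR (- y) - expR (- y)).
      by ring.
    by rewrite ee [leRHS]mulrC ler_wpM2l ?invr_ge0 ?(ltW c0)//; lra.
  rewrite /cst ler_pdivrMr// mulrC ler_wpM2l ?invr_ge0 ?(ltW c0)//.
  by lra.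
- rewrite -[X in _ --> X]mulr1; apply: cvgM => //; exact: cvg_cst.
- exact: cvg_cst.
Unshelve. all: by end_near. Qed.

End riemann_exponential.

(** * Law of the solution *)

Section law_of_solution.
Context {R : realType} {m n : nat} {d : measure_display} {Omega : measurableType d}.
Variables (A : 'M[R]_m) (phi : 'I_m -> R) (v : 'I_m -> 'cV[R]_m).
Hypothesis hA : A *m A^T = A^T *m A.
Hypothesis hv : orthonormal_family v.
Hypothesis heig : forall j, (A + A^T) *m v j = phi j *: v j.
Hypothesis phi_gt0 : forall j, 0 < phi j.
Variables (sigma : 'M[R]_(m, n)) (P : probability Omega R).
Hypothesis hsigma : sigma *m sigma^T = 1%:M.
Variables (L : R -> {RV P >-> 'cV[R]_n}) (x : 'cV[R]_m) (X : R -> {RV P >-> 'cV[R]_m}).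
Hypothesis hL : standard_brownian_motion L.
Hypothesis hX : sde_solution A sigma L x X.

(** The integral of cos (S k + a + b) has two limits, which must agree: bounded convergence along
    almost every path gives the left-hand side, convergence of the variances V k the right-hand
    side. *)
Lemma charfun_solution (T : R) (u : 'cV[R]_m) (b : R) : 0 < T ->
  \int[P]_w cos (inner u (X T w) + b) =
  cos (inner u (expmx (- T *: A) *m x) + b) *
    expR (- ((\sum_l (phi l)^-1 * (1 - expR (- (phi l * T))) * inner (v l) u ^+ 2) / 2)).
Proof.
move=> T0; have [L0 cL _ _] := hL.
pose grid (k j : nat) : R := j%:R * (T / k.+1%:R).
(* The adjoints carry the weights over to u, so that every summand is a linear form in a Brownian
   increment. *)
pose c k j : 'cV[R]_n := sigma^T *m (expmx (- (T - grid k j) *: A^T) *m u).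
pose a : R := inner u (expmx (- T *: A) *m x).
pose S k w := \sum_(j < k.+1) inner (c k j) (L (grid k j.+1) w - L (grid k j) w).
pose V k := \sum_(j < k.+1) (grid k j.+1 - grid k j) * inner (c k j) (c k j).
have h0 k : 0 < T / k.+1%:R by rewrite divr_gt0.
have gridS k j : grid k j.+1 - grid k j = T / k.+1%:R.
  by rewrite /grid -mulrBl -natrB// subSnn mul1r.
have SV k : gaussian_charfun P (S k) (V k).
  apply: (charfun_brownian_sum hL).
    by rewrite /grid mul0r.
  by move=> j _; rewrite -subr_gt0 gridS.
have cE k j (z : 'cV[R]_n) : inner (c k j) z =
    inner u (expmx (- (T - grid k j) *: A) *m (sigma *m z)).
  by rewrite !inner_mulmx tr_expmxN.
(* Here sigma sigma^T = 1 eliminates sigma and leaves the norm of e^{-sA^T} u. *)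
have ccE k j : inner (c k j) (c k j) =
    \sum_l expR (- (phi l * (T - grid k j))) * inner (v l) u ^+ 2.
  rewrite -(inner_expmx_gram_sum hA hv heig) /c inner_mulmx trmxK mulmxA hsigma.
  by rewrite mul1mx.
have cV : V k @[k --> \oo] -->
    \sum_l (phi l)^-1 * (1 - expR (- (phi l * T))) * inner (v l) u ^+ 2.
  rewrite (_ : V = fun k => \sum_l (\sum_(j < k.+1) T / k.+1%:R *
     expR (- (phi l * (T - j%:R * (T / k.+1%:R))))) * inner (v l) u ^+ 2); last first.
    apply/funext => k; rewrite /V.
    under eq_bigr do rewrite gridS ccE mulr_sumr.
    rewrite exchange_big/=; apply: eq_bigr => l _.
    by rewrite mulr_suml; apply: eq_bigr => j _; rewrite mulrA.
  apply: cvg_sum_seq => l; apply: cvgM; last exact: cvg_cst.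
  exact: cvg_exponential_sum.
have aeS : {ae P, forall w, S k w @[k --> \oo] --> inner u (X T w) - a}.
  move: L0 cL hX; apply: filterS3 => w L0 cL [cX eqX].
  rewrite (_ : S ^~ w = fun k => \sum_(j < k.+1) inner u (expmx (- (T - grid k j) *: A) *m
     (sigma *m (L (grid k j.+1) w - L (grid k j) w)))); last first.
    by apply/funext => k; apply: eq_bigr => j _; rewrite cE.
  exact: (@cvg_variation_of_constants R m n A sigma x (fun t => X t w) (fun t => L t w)
    cX cL L0 eqX T u T0).
have mSk k : measurable_fun setT (S k).
  apply: measurable_sum => j.
  apply: (measurableT_comp (measurable_inner _)).
  by apply: measurable_addmx => //; exact: measurable_oppmx.
have mcos (f : Omega -> R) (e : R) : measurable_fun setT f ->
    measurable_fun setT (fun w => cos (f w + e)).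
  by move=> mf; exact: (measurableT_comp (measurable_cos_shift e)).
have mXT : measurable_fun setT (fun w => inner u (X T w)).
  exact: (measurableT_comp (measurable_inner u)).
have c1 : \int[P]_w cos (S k w + (a + b)) @[k --> \oo] -->
    \int[P]_w cos (inner u (X T w) + b).
  apply: (@bounded_cvg_Rintegral _ _ _ P _ _ 1).
  - by move=> k; exact: mcos.
  - exact: mcos.
  - by move=> k w; exact: cos_max.
  - apply: filterS aeS => w cSw.
    have -> : inner u (X T w) + b = inner u (X T w) - a + (a + b) by ring.
    apply: (@cvg_comp _ _ _ (fun k => S k w + (a + b)) cos _
      (nbhs (inner u (X T w) - a + (a + b)))).
      by apply: cvgD => //; exact: cvg_cst.
    exact: continuous_cos.
set V' := \sum_l _ in cV *.
have c2 : \int[P]_w cos (S k w + (a + b)) @[k --> \oo] -->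
    cos (a + b) * expR (- (V' / 2)).
  under eq_fun do rewrite SV.
  apply: cvgM; first exact: cvg_cst.
  apply: (@cvg_comp _ _ _ (fun k => - (V k / 2)) expR _ (nbhs (- (V' / 2)))).
    by apply: cvgN; apply: cvgM => //; exact: cvg_cst.
  exact: continuous_expR.
by rewrite -(cvg_lim (@Rhausdorff R) c1) (cvg_lim (@Rhausdorff R) c2).
Qed.

Variable mu : probability 'cV[R]_m R.
Hypothesis hmu : gaussian_law 0 (Sigma_infty A) mu.

Lemma charfun_stationary (u : 'cV[R]_m) (b : R) :
  \int[mu]_y cos (inner u y + b) =
  cos b * expR (- ((\sum_l (phi l)^-1 * inner (v l) u ^+ 2) / 2)).
Proof.
rewrite (charfun_gaussian_law u b hmu) inner0r add0r.
by rewrite (inner_Sigma_infty hA hv heig phi_gt0).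
Qed.

Definition contraction (T : R) : 'M[R]_m :=
  spectral_mx v (fun l => Num.sqrt (1 - expR (- (phi l * T)))).

(* Both sides have the same characteristic function, because the contraction
   turns the stationary covariance diag(1 / phi) into diag((1 - e^(-phi T)) / phi). *)
Lemma law_solution (T : R) : 0 < T -> forall B : set 'cV[R]_m, measurable B ->
  distribution P (X T) B =
  pushforward mu (fun y => expmx (- T *: A) *m x + contraction T *m y) B.
Proof.
move=> T0.
set a := expmx _ *m x; set K := contraction T.
pose Y : {RV mu >-> 'cV[R]_m} := mfun_Sub (mem_set (measurable_affine a K)).
have := @charfun_unique R m (distribution P (X T)) (distribution mu Y).
move=> H B mB; apply: (H _ B mB) => u b.
have fb (z : 'cV[R]_m) : `|cos (inner u z + b)| <= 1 by exact: cos_max.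
rewrite (Rintegral_distribution (X T) (measurable_cos_inner u b) fb).
rewrite (Rintegral_distribution Y (measurable_cos_inner u b) fb).
rewrite charfun_solution//.
have -> : \int[mu]_w cos (inner u (Y w) + b) =
    \int[mu]_w cos (inner (K^T *m u) w + (inner u a + b)).
  by apply: eq_Rintegral => w _ /=; rewrite innerDr inner_mulmx; congr cos; ring.
rewrite charfun_stationary; congr (_ * expR (- (_ / 2))).
apply: eq_bigr => l _; rewrite tr_spectral_mx (inner_spectral_mx hv) exprMn.
rewrite sqr_sqrtr ?mulrA//.
by rewrite sub1_expRN mulr_ge0 ?(ltW (phi_gt0 l))// ltW.
Qed.

End law_of_solution.

(** * Eigenvalues of A and of its symmetric part *)

Lemma char_poly_similar (F : fieldType) n (A D S : 'M[F]_n) :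
  S \in unitmx -> S *m A = D *m S -> char_poly A = char_poly D.
Proof.
move=> Su SA; have detS : \det (map_mx polyC S) != 0.
  by rewrite det_map_mx polyC_eq0 -unitfE -unitmxE.
apply: (mulfI detS); rewrite /char_poly -det_mulmx mulrC -det_mulmx.
congr (\det _); rewrite /char_poly_mx mulmxBr mulmxBl -!map_mxM SA.
by rewrite scalar_mxC.
Qed.

Lemma char_poly_diag (F : fieldType) n (D : 'rV[F]_n) :
  char_poly (diag_mx D) = \prod_(j < n) ('X - (D 0 j)%:P).
Proof.
rewrite char_poly_trig ?diag_mx_is_trig//.
by apply: eq_bigr => j _; rewrite mxE eqxx mulr1n.
Qed.

Lemma prod_XsubC_perm (F : fieldType) n (a b : 'I_n -> F) :
  \prod_(j < n) ('X - (a j)%:P) = \prod_(j < n) ('X - (b j)%:P) ->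
  perm_eq [seq a j | j <- enum 'I_n] [seq b j | j <- enum 'I_n].
Proof.
by move=> ab; apply: prod_XsubC_eq; rewrite !big_map -enumT !big_enum.
Qed.

Lemma monotone_perm_eq (R : realDomainType) n (a b : 'I_n -> R) :
  (forall i j : 'I_n, (i <= j)%N -> a i <= a j) ->
  (forall i j : 'I_n, (i <= j)%N -> b i <= b j) ->
  perm_eq [seq a j | j <- enum 'I_n] [seq b j | j <- enum 'I_n] -> a =1 b.
Proof.
have srt (c : 'I_n -> R) : (forall i j : 'I_n, (i <= j)%N -> c i <= c j) ->
    sorted <=%R [seq c j | j <- enum 'I_n].
  move=> cm; rewrite sorted_map.
  apply: (@sub_sorted _ (relpre val leq)) => [i j /= ij|]; first exact: cm.
  by rewrite -sorted_map val_enum_ord iota_sorted.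
move=> am bm ab i.
have /eq_in_map := le_sorted_eq (srt _ am) (srt _ bm) ab.
by apply; rewrite mem_enum.
Qed.

(** One unitary matrix diagonalises B and its adjoint at once, with conjugate entries; it therefore
    also diagonalises their sum. *)
Lemma spectralmx_adjoint (C : numClosedFieldType) n (B : 'M[C]_n) :
  B \is normalmx ->
  spectralmx B *m B = diag_mx (spectral_diag B) *m spectralmx B /\
  spectralmx B *m (B ^t*)%sesqui =
    diag_mx (map_mx Num.conj (spectral_diag B)) *m spectralmx B.
Proof.
move=> /orthomx_spectralP BE; have Su := spectral_unit B.
split; first by rewrite {2}BE -mulmxA mulKVmx.
rewrite {2}BE invmx_unitary ?spectral_unitarymx//.
rewrite !trmx_mul !map_mxM map_trmx trmxK -map_mx_comp.
rewrite tr_diag_mx map_diag_mx (map_mx_id (@conjCK _)).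
by rewrite -[map_mx _ _]invmx_unitary ?spectral_unitarymx// mulKVmx.
Qed.

Section eigenvalues_real_part.
Context {R : realType} {n : nat}.
Variables (A : 'M[R]_n) (phi : 'I_n -> R) (v : 'I_n -> 'cV[R]_n).
Hypothesis hA : A *m A^T = A^T *m A.
Hypothesis hphi : forall i j : 'I_n, (i <= j)%N -> phi i <= phi j.
Hypothesis hv : orthonormal_family v.
Hypothesis heig : forall j, (A + A^T) *m v j = phi j *: v j.
Variable lambda : 'I_n -> R[i].
Hypothesis hlambda : eigenvalues_of A lambda.
Hypothesis hRe : forall i j : 'I_n, (i <= j)%N ->
  complex.Re (lambda i) <= complex.Re (lambda j).

Let toC : {rmorphism R -> R[i]} := real_complex R.

Let B : 'M[R[i]]_n := map_mx toC A.

Let BE : (B ^t*)%sesqui = map_mx toC A^T.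
Proof. by apply/matrixP => i j; rewrite !mxE; exact: conjc_real. Qed.

Let S : 'M[R[i]]_n := spectralmx B.
Let sp : 'rV[R[i]]_n := spectral_diag B.

Let B_normal : B \is normalmx.
Proof. by apply/normalmxP; rewrite BE -!map_mxM hA. Qed.

Let char_poly_symmetric : char_poly (A + A^T) = \prod_(j < n) ('X - (phi j)%:P).
Proof.
have VV := basis_mx_orthogonal hv.
rewrite (@char_poly_similar _ _ _ (diag_mx (\row_j phi j)) (basis_mx v)^T).
- by rewrite char_poly_diag; apply: eq_bigr => j _; rewrite mxE.
- by rewrite unitmx_tr; have [] := mulmx1_unit VV.
- apply: trmx_inj; rewrite !trmx_mul trmxK tr_diag_mx linearD/= trmxK addrC.
  apply/matrixP => i j; rewrite mul_mx_diag [RHS]mxE mxE.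
  have /matrixP /(_ i 0) := heig j; rewrite !mxE => h.
  rewrite mulrC -h; apply: eq_bigr => k _; by rewrite !mxE.
Qed.

(* Over the complex numbers A is unitarily diagonal with spectrum sp, so that
   A + A^* has spectrum 2 Re sp; both lists being sorted, they agree termwise. *)
Lemma eigenvalue_real_part j : phi j = 2 * complex.Re (lambda j).
Proof.
have Su : S \in unitmx by exact: spectral_unit.
have [SB SBt] := spectralmx_adjoint B_normal; rewrite -/S -/sp in SB SBt.
have perm1 : perm_eq [seq lambda j | j <- enum 'I_n] [seq sp 0 j | j <- enum 'I_n].
  apply: prod_XsubC_perm; rewrite -hlambda -char_poly_diag.
  exact: (char_poly_similar Su).
have perm2 : perm_eq [seq toC (phi j) | j <- enum 'I_n]
    [seq toC (2 * complex.Re (sp 0 j)) | j <- enum 'I_n].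
  apply: prod_XsubC_perm.
  have -> : \prod_(j < n) ('X - (toC (phi j))%:P) = char_poly (map_mx toC (A + A^T)).
    rewrite -map_char_poly char_poly_symmetric rmorph_prod.
    by apply: eq_bigr => k _; rewrite rmorphB/= map_polyX map_polyC.
  have -> : \prod_(j < n) ('X - (toC (2 * complex.Re (sp 0 j)))%:P) =
      char_poly (diag_mx (\row_j toC (2 * complex.Re (sp 0 j)))).
    by rewrite char_poly_diag; apply: eq_bigr => k _; rewrite mxE.
  apply: (char_poly_similar Su).
  (* For a real matrix the adjoint is the transpose, so [S] diagonalises A + A^T with the entries z
     + conj z = 2 Re z. *)
  rewrite map_mxD -BE -/B.
  rewrite mulmxDr SB SBt -mulmxDl -raddfD/=; congr (diag_mx _ *m _).
  apply/matrixP => i k; rewrite !mxE ord1 (rmorphM toC) (rmorph_nat toC).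
  exact: addcJ.
have perm3 : perm_eq [seq phi j | j <- enum 'I_n]
    [seq 2 * complex.Re (lambda j) | j <- enum 'I_n].
  have := perm_map (@complex.Re R) perm2; rewrite -!map_comp => p2.
  apply: (perm_trans p2).
  have := perm_map (fun z => 2 * complex.Re z) perm1; rewrite -!map_comp => p1.
  by rewrite perm_sym.
apply: (monotone_perm_eq hphi _ perm3) => i k ik.
by rewrite ler_wpM2l// hRe.
Qed.

End eigenvalues_real_part.

(** * Moments read off the characteristic function *)

Section moments.
Context {R : realType} {n : nat}.
Variables (mu : probability 'cV[R]_n R) (Q : 'cV[R]_n -> R).
Hypothesis QZ : forall s u, Q (s *: u) = s ^+ 2 * Q u.
Hypothesis charfun_mu : forall u b,
  \int[mu]_y cos (inner u y + b) = cos b * expR (- (Q u / 2)).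

(** By Caratheodory, sin w = g(w) w with g continuous at 0 and g(0) = cos 0 = 1. *)
Lemma cvg_sin_scaled (z : R) : k.+1%:R * sin (z / k.+1%:R) @[k --> \oo] --> z.
Proof.
have [g [gE cg g0]] := (is_derive1_caratheodory _ _ _).1 (is_derive_sin (0 : R)).
rewrite (_ : (fun k => _) = fun k => g (z * k.+1%:R^-1) * z); last first.
  apply/funext => k; have := gE (z / k.+1%:R).
  rewrite sin0 !subr0 => ->.
  have : (k.+1%:R : R) != 0 by rewrite pnatr_eq0.
  by move: (k.+1%:R : R) => p p0; field.
rewrite -[X in _ --> X]mul1r; apply: cvgM; last exact: cvg_cst.
have g1 : g 0 = 1 by rewrite g0 cos0.
rewrite -[X in _ --> X]g1.
have hz : z * k.+1%:R^-1 @[k --> \oo] --> (0 : R).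
  by rewrite -[X in _ --> X](mulr0 z); apply: cvgM; [exact: cvg_cst|exact: cvg_harmonic].
exact: (@cvg_comp _ _ _ (fun k => z * k.+1%:R^-1) g _ (nbhs (0 : R)) _ hz cg).
Qed.

(** The factor 2 prepares the half-angle formula: the squared sine of <u, y> / N k becomes a cosine
    of <u, y> / (k + 1). *)
Let N (k : nat) : R := 2 * k.+1%:R.

(* f u k y tends to <u, y>^2, and by fE its integral is read off the
   characteristic function. *)
Let f (u : 'cV[R]_n) k (y : 'cV[R]_n) : R := (N k * sin (inner u y / N k)) ^+ 2.

Let fE u k y : f u k y = N k ^+ 2 / 2 * (1 - cos (inner ((k.+1%:R)^-1 *: u) y + 0)).
Proof.
rewrite addr0 innerZl (_ : _ * inner u y = (inner u y / N k) *+ 2); last first.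
  rewrite /N -mulr_natr; have : (k.+1%:R : R) != 0 by rewrite pnatr_eq0.
  by move: (k.+1%:R : R) => p p0; field.
rewrite cos_mulr2n /f exprMn.
have := cos2Dsin2 (inner u y / N k); rewrite -mulr_natr => h.
have -> : sin (inner u y / N k) ^+ 2 = 1 - cos (inner u y / N k) ^+ 2 by rewrite -h; ring.
by field.
Qed.

Let measurable_f u k : measurable_fun setT (f u k).
Proof.
rewrite (_ : f u k = fun y => N k ^+ 2 / 2 * (1 - cos (inner ((k.+1%:R)^-1 *: u) y + 0))).
  by apply: measurable_funM => //; apply: measurable_funB => //; exact: measurable_cos_inner.
by apply/funext => y; rewrite fE.
Qed.

(** From 1 - e^{-s} <= s with s = Q(u / (k+1)) / 2; the homogeneity of Q then cancels the prefactor
    (N k)^2 / 2 = 2 (k+1)^2. *)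
Let integral_f_le u k : (\int[mu]_y (f u k y)%:E <= (Q u)%:E)%E.
Proof.
pose c : 'cV[R]_n := k.+1%:R^-1 *: u.
have ic : mu.-integrable setT (EFin \o (fun y => cos (inner c y + 0))).
  apply: (@bounded_integrable _ _ _ mu _ 1); first exact: measurable_cos_inner.
  by move=> y; exact: cos_max.
have i1 : mu.-integrable setT (EFin \o (fun=> 1 : R)).
  by apply: (@bounded_integrable _ _ _ mu _ 1) => // y; rewrite normr1.
have id1 : mu.-integrable setT (EFin \o (fun y => 1 - cos (inner c y + 0))).
  exact: (integrableB measurableT i1 ic).
have ifk : mu.-integrable setT (EFin \o f u k).
  rewrite (_ : f u k = fun y => N k ^+ 2 / 2 * (1 - cos (inner c y + 0))).
    exact: (integrableZl measurableT (N k ^+ 2 / 2) id1).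
  by apply/funext => y; rewrite fE.
rewrite -[leLHS]fineK; last exact: integrable_fin_num.
rewrite lee_fin.
have -> : fine (\int[mu]_y (f u k y)%:E)%E =
    \int[mu]_y (N k ^+ 2 / 2 * (1 - cos (inner c y + 0))).
  by apply: eq_Rintegral => y _; rewrite fE.
rewrite RintegralZl// RintegralB// Rintegral_cst_probability charfun_mu cos0 mul1r.
have h := expR_ge1Dx (- (Q c / 2)).
apply: (@le_trans _ _ (N k ^+ 2 / 2 * (Q c / 2))).
  by rewrite ler_wpM2l ?divr_ge0 ?sqr_ge0//; lra.
rewrite /c QZ /N le_eqVlt; apply/orP; left; apply/eqP.
have : (k.+1%:R : R) != 0 by rewrite pnatr_eq0.
by move: (k.+1%:R : R) => p p0; field.
Qed.

(** Fatou's lemma applied to [f u k]; the inequality suffices for integrability. *)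
Lemma second_moment_le u : (\int[mu]_y (inner u y ^+ 2)%:E <= (Q u)%:E)%E.
Proof.
have h := @fatou _ _ _ mu setT measurableT (fun k y => (f u k y)%:E).
have cf y : (f u k y)%:E @[k --> \oo] --> (inner u y ^+ 2)%:E.
  suff cr : f u k y @[k --> \oo] --> inner u y ^+ 2 by exact: cvg_EFin (nearW _ _) cr.
  rewrite (_ : (fun k => f u k y) = fun k => (2 * (k.+1%:R * sin (inner u y / 2 / k.+1%:R))) ^+ 2).
    have -> : inner u y ^+ 2 = (2 * (inner u y / 2)) ^+ 2 by field.
    apply: (@cvg_comp _ _ _ (fun k => 2 * (k.+1%:R * sin (inner u y / 2 / k.+1%:R)))
      (fun x => x ^+ 2) _ (nbhs (2 * (inner u y / 2)))).
      by apply: cvgM; [exact: cvg_cst|exact: cvg_sin_scaled].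
    exact: exprn_continuous.
  apply/funext => k; rewrite /f /N mulrA; congr ((_ * sin _) ^+ 2).
  have : (k.+1%:R : R) != 0 by rewrite pnatr_eq0.
  by move: (k.+1%:R : R) => p p0; field.
apply: (@le_trans _ _ (\int[mu]_y limn_einf (fun k => (f u k y)%:E))%E).
  by rewrite le_eqVlt; apply/orP; left; apply/eqP; apply: eq_integral => y _;
    rewrite (cvg_limn_einf_sup (cf y)).1.
apply: le_trans (h _ _) _.
- by move=> k; apply/measurable_EFinP; exact: measurable_f.
- by move=> k y _; rewrite lee_fin sqr_ge0.
rewrite limn_einf_lim; apply: lime_le; first exact: is_cvg_einfs.
apply: nearW => k; apply: le_trans (integral_f_le u k).
by apply: ereal_inf_lbound; exists k => //=.
Qed.

Lemma measurable_inner_sqr (u : 'cV[R]_n) : measurable_fun setT (fun y => inner u y ^+ 2).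
Proof. by apply: measurable_funX; exact: measurable_inner. Qed.

Lemma integrable_inner_sqr u : mu.-integrable setT (EFin \o (fun y => inner u y ^+ 2)).
Proof.
apply/integrableP; split; first by apply/measurable_EFinP; exact: measurable_inner_sqr.
under eq_integral => y _ do rewrite /= ger0_norm ?sqr_ge0//.
exact: le_lt_trans (second_moment_le u) (ltry _).
Qed.

Lemma integrable_inner u : mu.-integrable setT (EFin \o inner u).
Proof.
have i1 : mu.-integrable setT (EFin \o (fun=> 1 : R)).
  by apply: (@bounded_integrable _ _ _ mu _ 1) => // y; rewrite normr1.
apply: (le_integrable measurableT _ _ (integrableD measurableT i1 (integrable_inner_sqr u))).
  by apply/measurable_EFinP; exact: measurable_inner.
move=> y _; rewrite /= lee_fin [leRHS]ger0_norm ?addr_ge0 ?sqr_ge0//.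
have := sqr_ge0 (`|inner u y| - 1); rewrite -[inner u y ^+ 2]real_normK ?num_real//.
by have := normr_ge0 (inner u y); nra.
Qed.

(* The characteristic function makes mu invariant under y |-> - y. *)
Lemma mean_inner u : \int[mu]_y inner u y = 0.
Proof.
pose Y : {RV mu >-> 'cV[R]_n} := mfun_Sub (mem_set (measurable_affine 0 (- 1%:M : 'M[R]_n))).
have YE y : inner u (Y y) = - inner u y.
  by rewrite /= add0r mulNmx mul1mx innerNr.
have sym : forall B, measurable B -> distribution mu Y B = mu B.
  apply: charfun_unique => c b.
  rewrite (Rintegral_distribution Y (measurable_cos_inner c b) (fun z => cos_max _)).
  transitivity (\int[mu]_y cos (inner (- c) y + b)).
    by apply: eq_Rintegral => y _; rewrite /= add0r mulNmx mul1mx innerNr innerNl.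
  rewrite charfun_mu charfun_mu -(scaleN1r c) QZ; congr (_ * expR (- (_ / 2))).
  by rewrite sqrrN expr1n mul1r.
have e : \int[mu]_y inner u y = - \int[mu]_y inner u y.
  rewrite -{1}[\int[mu]_y _]mul1r.
  transitivity (\int[distribution mu Y]_y inner u y).
    rewrite mul1r /Rintegral; congr fine; apply: eq_measure_integral => B mB _.
    exact/esym/sym.
  rewrite /Rintegral integral_distribution.
  - transitivity (\int[mu]_y ((-1) * inner u y)).
      by apply: eq_Rintegral => y _; rewrite YE mulN1r.
    by rewrite RintegralZl ?mulN1r//; exact: integrable_inner.
  - by apply/measurable_EFinP; exact: measurable_inner.
  - rewrite (_ : _ \o _ = EFin \o (fun y => (-1) * inner u y)).
      exact: (integrableZl measurableT (-1) (integrable_inner u)).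
    by apply/funext => y /=; rewrite mulN1r; congr EFin; exact: YE.
lra.
Qed.

(** A vanishing second moment would make <u, y> zero almost everywhere and the characteristic
    function at u equal to 1, whereas it is e^{- Q(u) / 2} < 1. *)
Lemma second_moment_gt0 u : 0 < Q u -> 0 < \int[mu]_y (inner u y ^+ 2).
Proof.
move=> Qu; rewrite lt0r Rintegral_ge0 ?andbT; last by move=> y _; rewrite sqr_ge0.
apply/eqP => I0.
have int0 : (\int[mu]_y `|(inner u y ^+ 2)%:E|)%E = 0%E.
  rewrite (eq_integral (fun y => (inner u y ^+ 2)%:E)); last first.
    by move=> y _; rewrite /= ger0_norm ?sqr_ge0.
  rewrite -[LHS]fineK ?integrable_fin_num//; last exact: integrable_inner_sqr.
  by move: I0; rewrite /Rintegral => ->.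
have ae0 : ae_eq mu setT (EFin \o (fun y => inner u y ^+ 2)) (cst 0%E).
  apply/(ae_eq_integral_abs mu measurableT) => //.
  by apply/measurable_EFinP; exact: measurable_inner_sqr.
have : \int[mu]_y cos (inner u y + 0) = 1.
  rewrite -[RHS](Rintegral_cst_probability mu 1) /Rintegral; congr fine.
  apply: ae_eq_integral => //.
  - by apply/measurable_EFinP; exact: measurable_cos_inner.
  apply: filterS ae0 => y /= /(_ Logic.I) [] /eqP; rewrite sqrf_eq0 => /eqP -> _.
  by rewrite addr0 cos0.
rewrite charfun_mu cos0 mul1r => /eqP; apply/negP; rewrite lt_eqF//.
by rewrite -[ltRHS]expR0 ltr_expR; lra.
Qed.

End moments.

(** * Bounds on the Wasserstein distance *)

Section image_law.
Context {R : realType} {d d' : measure_display}.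
Context {X : measurableType d} {Y : measurableType d'}.
Variables (T : probability X R) (nu : probability Y R) (pr : X -> Y).
Hypothesis mpr : measurable_fun setT pr.
Hypothesis prE : forall B, measurable B -> T (pr @^-1` B) = nu B.

Let Z : {RV T >-> Y} := mfun_Sub (mem_set mpr).

Lemma integrable_image_law (f : Y -> R) :
  nu.-integrable setT (EFin \o f) -> T.-integrable setT (EFin \o (f \o pr)).
Proof.
move=> /integrableP [mf If].
have mf' := (measurable_EFinP _ _).1 mf.
apply/integrableP; split; first by apply/measurable_EFinP; exact: measurableT_comp.
rewrite -(@ge0_integral_distribution _ _ _ _ _ T Z (fun y => `|(f y)%:E|%E))//; last first.
  exact: measurableT_comp.
rewrite (eq_measure_integral nu)// => B mB _.
exact: prE.
Qed.

Lemma Rintegral_image_law (f : Y -> R) :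
  nu.-integrable setT (EFin \o f) -> \int[T]_x f (pr x) = \int[nu]_y f y.
Proof.
move=> intf; have /integrableP [mf _] := intf.
rewrite /Rintegral; congr fine.
rewrite -(@integral_distribution _ _ _ _ _ T Z (EFin \o f) mf).
  by apply: eq_measure_integral => B mB _; exact: prE.
exact: integrable_image_law.
Qed.

End image_law.

Section wasserstein_bounds.
Context {R : realType} {n : nat}.
Implicit Types nu mu : probability 'cV[R]_n R.

Lemma sqnorm_ge0 (u : 'cV[R]_n) : 0 <= sqnorm u.
Proof. by apply: sumr_ge0 => i _; rewrite -expr2 sqr_ge0. Qed.

Lemma measurable_sqnorm_sub :
  measurable_fun setT (fun z : 'cV[R]_n * 'cV[R]_n => sqnorm (z.1 - z.2)).
Proof.
apply: measurable_sum => i; apply: measurable_funM.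
all: rewrite (_ : (fun _ => _) = fun z : 'cV[R]_n * 'cV[R]_n => z.1 i 0 - z.2 i 0);
  last by apply/funext => z; rewrite !mxE.
all: apply: measurable_funB.
all: by [apply: (measurableT_comp (measurable_coord i)); exact: measurable_fst|
  apply: (measurableT_comp (measurable_coord i)); exact: measurable_snd].
Qed.

Lemma eq_wasserstein2 nu nu' mu :
  (forall B, measurable B -> nu B = nu' B) -> wasserstein2 nu mu = wasserstein2 nu' mu.
Proof.
move=> e; rewrite /wasserstein2; congr (sqrte (ereal_inf (_ @` _))).
by apply/seteqP; split => T cT B mB; have [? ?] := cT B mB; rewrite ?e// -?e.
Qed.

(** The elementary half of Kantorovich duality: the inequality between potentials and cost is
    integrated against an arbitrary coupling. *)
Lemma duality_wasserstein2 nu mu (f g : 'cV[R]_n -> R) (c : R) :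
  nu.-integrable setT (EFin \o f) -> mu.-integrable setT (EFin \o g) ->
  (forall z1 z2, f z1 - g z2 <= sqnorm (z1 - z2)) ->
  0 <= c -> c ^+ 2 <= \int[nu]_z f z - \int[mu]_z g z ->
  (c%:E <= wasserstein2 nu mu)%E.
Proof.
move=> intf intg fg c0 cI.
have -> : c%:E = sqrte (c ^+ 2)%:E by rewrite /= sqrtr_sqr ger0_norm.
have I0 : (0 <= ereal_inf [set (\int[T]_z (sqnorm (z.1 - z.2))%:E)%E
    | T in is_coupling nu mu])%E.
  by apply/ereal_infP => _ [T _ <-]; apply: integral_ge0 => z _; rewrite lee_fin sqnorm_ge0.
rewrite lee_sqrt//; apply/ereal_infP => _ [T cT <-].
have h1 : forall B, measurable B -> T (fst @^-1` B) = nu B.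
  move=> B mB; rewrite -(cT B mB).1; congr (T _).
  by apply/seteqP; split => z //= [].
have h2 : forall B, measurable B -> T (snd @^-1` B) = mu B.
  move=> B mB; rewrite -(cT B mB).2; congr (T _).
  by apply/seteqP; split => z //= [].
have i1 := integrable_image_law measurable_fst h1 intf.
have i2 := integrable_image_law measurable_snd h2 intg.
have i12 := integrableB measurableT i1 i2.
apply: (@le_trans _ _ (\int[T]_z (f z.1 - g z.2)%:E)%E).
  rewrite -[leRHS]fineK; last exact: integrable_fin_num.
  rewrite lee_fin; apply: (le_trans cI).
  rewrite -(Rintegral_image_law measurable_fst h1 intf).
  by rewrite -(Rintegral_image_law measurable_snd h2 intg) -RintegralB.
set S := (\int[T]_z (sqnorm _)%:E)%E.
(* An infinite cost makes the bound trivial; a finite one makes the cost integrable, as the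
   comparison of integrals requires. *)
have [Sfin|] := boolP (S \is a fin_num); last first.
  rewrite ge0_fin_numE -?leNgt ?leye_eq; first by move=> /eqP ->; rewrite leey.
  by apply: integral_ge0 => z _; rewrite lee_fin sqnorm_ge0.
apply: le_integral => //.
- apply/integrableP; split.
    by apply/measurable_EFinP; exact: measurable_sqnorm_sub.
  under eq_integral => z _ do rewrite /= ger0_norm ?sqnorm_ge0//.
  by rewrite -/S ltey_eq Sfin.
- by move=> z _; rewrite lee_fin fg.
Qed.

Lemma coupling_wasserstein2 mu (Y : {RV mu >-> 'cV[R]_n}) (c : R) :
  0 <= c -> (\int[mu]_y (sqnorm (Y y - y))%:E <= (c ^+ 2)%:E)%E ->
  (wasserstein2 (distribution mu Y) mu <= c%:E)%E.
Proof.
move=> c0 cI.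
have -> : c%:E = sqrte (c ^+ 2)%:E by rewrite /= sqrtr_sqr ger0_norm.
rewrite lee_sqrt ?lee_fin ?sqr_ge0//.
have mZ : measurable_fun setT (fun y => (Y y, y)) by exact: measurable_fun_pair.
pose Z : {RV mu >-> ('cV[R]_n * 'cV[R]_n)%type} := mfun_Sub (mem_set mZ).
apply: ge_ereal_inf; exists (\int[mu]_y (sqnorm (Y y - y))%:E)%E => //.
exists (distribution mu Z).
  move=> B mB; rewrite /distribution /pushforward; split; congr (mu _).
    by apply/seteqP; split => y //= [].
  by apply/seteqP; split => y //= [].
rewrite ge0_integral_distribution//.
  by apply/measurable_EFinP; exact: measurable_sqnorm_sub.
by move=> z; rewrite lee_fin sqnorm_ge0.
Qed.

End wasserstein_bounds.

Section distance_to_stationary.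
Context {R : realType} {m : nat}.
Variables (phi : 'I_m -> R) (v : 'I_m -> 'cV[R]_m).
Hypothesis hv : orthonormal_family v.
Hypothesis phi_gt0 : forall j, 0 < phi j.
Variable mu : probability 'cV[R]_m R.

Let Q (u : 'cV[R]_m) : R := \sum_l (phi l)^-1 * inner (v l) u ^+ 2.

Hypothesis charfun_mu : forall u b,
  \int[mu]_y cos (inner u y + b) = cos b * expR (- (Q u / 2)).

Let QZ s u : Q (s *: u) = s ^+ 2 * Q u.
Proof.
rewrite /Q mulr_sumr; apply: eq_bigr => l _; rewrite innerZr exprMn; ring.
Qed.

Let k t l : R := Num.sqrt (1 - expR (- (phi l * t))).

Let expR01 t l : 0 <= t -> 0 <= expR (- (phi l * t)) <= 1.
Proof.
by move=> t0; rewrite expR_ge0 -[leRHS]expR0 ler_expR oppr_le0 mulr_ge0// ltW.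
Qed.

Let k_sqr t l : 0 <= t -> k t l ^+ 2 = 1 - expR (- (phi l * t)).
Proof. by move=> /(expR01 l)/andP[_ h]; rewrite sqr_sqrtr ?subr_ge0. Qed.

Let k_ge0 t l : 0 <= k t l. Proof. exact: sqrtr_ge0. Qed.

Let k_le1 t l : 0 <= t -> k t l <= 1.
Proof.
move=> t0; have := k_sqr l t0; have := k_ge0 t l; have := expR01 l t0.
by move=> /andP[? ?] ? ?; nra.
Qed.

(** For e = e^{- phi_l t} and 0 <= k <= 1, the identity e = (1 - k)(1 + k) places 1 - k between e /
    2 and e; the lower half is the next statement. *)
Let sub1k_le t l : 0 <= t -> 1 - k t l <= expR (- (phi l * t)).
Proof.
move=> t0; have := k_sqr l t0; have := k_ge0 t l; have := k_le1 l t0; nra.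
Qed.

Let sub1k_ge t l : 0 <= t -> expR (- (phi l * t)) / 2 <= 1 - k t l.
Proof.
move=> t0; have := k_sqr l t0; have := k_ge0 t l; have := k_le1 l t0; nra.
Qed.

Lemma sqnormD_le (a w : 'cV[R]_m) : sqnorm (a + w) <= 2 * sqnorm a + 2 * sqnorm w.
Proof.
have := sqnorm_ge0 (a - w); rewrite /sqnorm !innerDl !innerDr !innerNl !innerNr.
by rewrite (innerC w a); lra.
Qed.

Lemma sqnorm_sum (w : 'cV[R]_m) : sqnorm w = \sum_l inner (v l) w ^+ 2.
Proof. by rewrite /sqnorm (parseval hv); apply: eq_bigr => l _; rewrite expr2. Qed.

Lemma sqr_inner_le l (w : 'cV[R]_m) : inner (v l) w ^+ 2 <= sqnorm w.
Proof.
rewrite sqnorm_sum (bigD1 l)//= lerDl; apply: sumr_ge0 => j _; exact: sqr_ge0.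
Qed.

Lemma integrable_sqnorm : mu.-integrable setT (EFin \o @sqnorm R m).
Proof.
rewrite (_ : _ \o _ = fun w => (\sum_(l < m) (inner (v l) w ^+ 2)%:E)%E).
  by apply: integrable_sum => // l _; exact: (integrable_inner_sqr QZ charfun_mu).
by apply/funext => w /=; rewrite sqnorm_sum sumEFin.
Qed.

Variables (nu : probability 'cV[R]_m R) (a : 'cV[R]_m) (t : R).
Hypothesis t_ge0 : 0 <= t.
Hypothesis nuE : forall B, measurable B ->
  nu B = pushforward mu (fun y => a + contraction phi v t *m y) B.

Let mY : measurable_fun setT (fun y => a + contraction phi v t *m y).
Proof. exact: measurable_affine. Qed.

Let Y : {RV mu >-> 'cV[R]_m} := mfun_Sub (mem_set mY).

Let nuY : forall B, measurable B -> mu ((fun y => a + contraction phi v t *m y) @^-1` B) = nu B.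
Proof. by move=> B mB; rewrite nuE. Qed.

Let integrable_nu (f : 'cV[R]_m -> R) : measurable_fun setT f ->
  mu.-integrable setT (EFin \o (fun y => f (a + contraction phi v t *m y))) ->
  nu.-integrable setT (EFin \o f).
Proof.
move=> mf /integrableP[_ fY].
apply/integrableP; split; first exact/measurable_EFinP.
rewrite (eq_measure_integral (distribution mu Y)); last by move=> B mB _; exact: nuE.
rewrite ge0_integral_distribution//.
by apply/measurable_EFinP; apply: measurableT_comp.
Qed.

Let inner_contraction l y : inner (v l) (contraction phi v t *m y) = k t l * inner (v l) y.
Proof. exact: inner_spectral_mx. Qed.

Lemma sqnorm_contraction_sub q y : (forall l, q <= phi l) ->
  sqnorm (contraction phi v t *m y - y) <= expR (- (q * t)) ^+ 2 * sqnorm y.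
Proof.
move=> qphi; rewrite !sqnorm_sum mulr_sumr; apply: ler_sum => l _.
rewrite innerDr innerNr inner_contraction -[X in _ - X]mul1r -mulrBl exprMn.
rewrite ler_wpM2r ?sqr_ge0// -sqrrN opprB ler_sqr ?nnegrE ?subr_ge0 ?k_le1 ?expR_ge0//.
apply: le_trans (sub1k_le l t_ge0) _.
by rewrite ler_expR lerN2 ler_wpM2r.
Qed.

(** The cross term in |a + (K y - y)|^2 is absorbed at the price of a factor 2, which leaves the
    exponential rates untouched. *)
Lemma wasserstein2_le q c : (forall l, q <= phi l) -> 0 <= c ->
  2 * sqnorm a + 2 * (expR (- (q * t)) ^+ 2 * \int[mu]_y sqnorm y) <= c ^+ 2 ->
  (wasserstein2 nu mu <= c%:E)%E.
Proof.
move=> qphi c0 hc.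
rewrite (@eq_wasserstein2 _ _ _ (distribution mu Y)); last by move=> B mB; rewrite nuE.
apply: coupling_wasserstein2 => //.
set e := expR (- (q * t)) in hc *.
have i1 : mu.-integrable setT (EFin \o (fun=> 2 * sqnorm a)).
  by apply: (@bounded_integrable _ _ _ mu _ `|2 * sqnorm a|).
have i2 : mu.-integrable setT (EFin \o (fun y => 2 * e ^+ 2 * sqnorm y)).
  exact: (integrableZl measurableT (2 * e ^+ 2) integrable_sqnorm).
have i12 := integrableD measurableT i1 i2.
apply: (@le_trans _ _ (\int[mu]_y (2 * sqnorm a + 2 * e ^+ 2 * sqnorm y)%:E)%E).
  apply: ge0_le_integral => //.
  - by move=> y _; rewrite lee_fin sqnorm_ge0.
  - apply/measurable_EFinP.
    exact: (measurableT_comp measurable_sqnorm_sub (measurable_fun_pair mY _)).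
  - by have /integrableP[] := i12.
  move=> y _; rewrite lee_fin /= -addrA.
  apply: le_trans (sqnormD_le _ _) _.
  by rewrite lerD2l -mulrA ler_wpM2l// sqnorm_contraction_sub.
rewrite -[leLHS]fineK; last exact: integrable_fin_num.
rewrite lee_fin; apply: le_trans hc.
rewrite [leLHS](_ : _ = \int[mu]_y (2 * sqnorm a + 2 * e ^+ 2 * sqnorm y))//.
rewrite RintegralD// Rintegral_cst_probability.
have -> : \int[mu]_y (2 * e ^+ 2 * sqnorm y) = 2 * e ^+ 2 * \int[mu]_y sqnorm y.
  by apply: RintegralZl => //; exact: integrable_sqnorm.
by rewrite mulrA.
Qed.

(** The potentials 2 <a, z> - |a|^2 and 2 <a, z> come from |z1 - z2 - a|^2 >= 0. As mu is centred
    and nu has mean a, their integrals differ by exactly |a|^2. *)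
Lemma wasserstein2_ge_mean c : 0 <= c -> c ^+ 2 <= sqnorm a ->
  (c%:E <= wasserstein2 nu mu)%E.
Proof.
move=> c0 hc.
have iin u := integrable_inner QZ charfun_mu u.
have icst (s : R) : mu.-integrable setT (EFin \o (fun=> s)).
  by apply: (@bounded_integrable _ _ _ mu _ `|s|).
pose a2 := 2%:R *: a; pose K := contraction phi v t.
have ig : mu.-integrable setT (EFin \o inner a2) := iin _.
have iY : mu.-integrable setT (EFin \o (fun y => inner (K^T *m a2) y + sqnorm a)).
  exact: (integrableD measurableT (iin _) (icst _)).
have YE y : inner a2 (a + K *m y) - sqnorm a = inner (K^T *m a2) y + sqnorm a.
  by rewrite innerDr inner_mulmx innerZl /sqnorm; ring.
have iff : nu.-integrable setT (EFin \o (fun z => inner a2 z - sqnorm a)).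
  apply: integrable_nu.
    by apply: measurable_funB => //; exact: measurable_inner.
  rewrite (_ : (fun y => _) = fun y => inner (K^T *m a2) y + sqnorm a)//.
  by apply/funext => y; rewrite YE.
apply: (duality_wasserstein2 iff ig) => //.
  move=> z1 z2; have := sqnorm_ge0 (z1 - z2 - a).
  rewrite /a2 innerZl innerZl /sqnorm !innerDl !innerDr !innerNl !innerNr.
  by rewrite (innerC z1 a) (innerC z2 a) (innerC z2 z1); lra.
rewrite -(Rintegral_image_law mY nuY iff) (mean_inner QZ charfun_mu) subr0.
apply: le_trans hc _; rewrite le_eqVlt; apply/orP; left; apply/eqP.
transitivity (\int[mu]_y (inner (K^T *m a2) y + sqnorm a)).
  by rewrite RintegralD// Rintegral_cst_probability (mean_inner QZ charfun_mu) add0r.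
by apply: eq_Rintegral => y _; rewrite -YE.
Qed.

(* The potentials are the optimal ones for the centred Gaussians in direction
   v l, whose standard deviations are in the ratio r. *)
Lemma wasserstein2_ge_spread l s : a = 0 -> 0 < t -> 0 <= s ->
  s ^+ 2 <= \int[mu]_y (inner (v l) y ^+ 2) ->
  ((expR (- (phi l * t)) / 2 * s)%:E <= wasserstein2 nu mu)%E.
Proof.
move=> a0 t0 s0 hs; set q := \int[mu]_y _ in hs.
have isq := integrable_inner_sqr QZ charfun_mu (v l).
set r := k t l.
have r0 : 0 < r by rewrite sqrtr_gt0 subr_gt0 -[ltRHS]expR0 ltr_expR oppr_lt0 mulr_gt0.
have r1 : r <= 1 by exact: k_le1.
have YE y : inner (v l) (a + contraction phi v t *m y) = r * inner (v l) y.
  by rewrite a0 add0r inner_contraction.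
(* With these coefficients the slack in direction [v l] is the square (w - r u)^2 / r, which
   vanishes along the coupling (K y, y), where w = r u. *)
pose c1 := - ((1 - r) / r); pose c2 := - (1 - r).
have ig : mu.-integrable setT (EFin \o (fun y => c2 * inner (v l) y ^+ 2)).
  exact: (integrableZl measurableT c2 isq).
have iff : nu.-integrable setT (EFin \o (fun y => c1 * inner (v l) y ^+ 2)).
  apply: integrable_nu.
    by apply: measurable_funM => //; exact: measurable_inner_sqr.
  rewrite (_ : (fun y => _) = fun y => c1 * r ^+ 2 * inner (v l) y ^+ 2).
    exact: (integrableZl measurableT (c1 * r ^+ 2) isq).
  by apply/funext => y; rewrite YE; ring.
have h : expR (- (phi l * t)) / 2 <= 1 - r by exact: sub1k_ge.
have e0 : 0 <= expR (- (phi l * t)) by exact: expR_ge0.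
apply: (duality_wasserstein2 iff ig).
- move=> z1 z2; apply: le_trans (sqr_inner_le l (z1 - z2)).
  rewrite innerDr innerNr; move: (inner _ z1) (inner _ z2) => w u.
  rewrite -subr_ge0.
  have -> : (w - u) ^+ 2 - (c1 * w ^+ 2 - c2 * u ^+ 2) = (w - r * u) ^+ 2 / r.
    by rewrite /c1 /c2; field; rewrite gt_eqF.
  by rewrite divr_ge0 ?sqr_ge0// ltW.
- by rewrite mulr_ge0// divr_ge0.
rewrite -(Rintegral_image_law mY nuY iff).
have -> : \int[mu]_y (c1 * inner (v l) (a + contraction phi v t *m y) ^+ 2) = c1 * r ^+ 2 * q.
  rewrite -RintegralZl//; apply: eq_Rintegral => y _; rewrite YE; ring.
rewrite RintegralZl// -/q.
have -> : c1 * r ^+ 2 * q - c2 * q = (1 - r) ^+ 2 * q.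
  by rewrite /c1 /c2; field; rewrite gt_eqF.
rewrite exprMn ler_pM ?sqr_ge0// ler_sqr ?nnegrE ?divr_ge0//.
lra.
Qed.

End distance_to_stationary.

(** * From exponential rates to cutoff *)

Lemma near_ln_le {R : realType} (B : R) : \forall eps \near 0^'+, ln eps < - B.
Proof.
near=> eps.
have e0 : 0 < eps by near: eps; exact: nbhs_right_gt.
rewrite -[ltRHS](expRK (- B)) ltr_ln ?posrE ?expR_gt0//.
by near: eps; apply: nbhs_right_lt; exact: expR_gt0.
Unshelve. all: by end_near. Qed.

(** At time delta r^-1 |ln eps| the exponential equals eps^delta, so the ratio is comparable to
    eps^(delta - 1), whose behaviour changes at delta = 1. *)
Lemma exponential_cutoff {R : realType} {d : measure_display}
    {Omega : measurableType d} (P : probability Omega R) (n : nat)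
    (X : R -> {RV P >-> 'cV[R]_n}) (mu : probability 'cV[R]_n R) (r c C : R) :
  0 < r -> 0 < c -> 0 <= C ->
  (forall t, 0 < t ->
    ((c * expR (- (r * t)))%:E <= wasserstein2 (distribution P (X t)) mu)%E) ->
  (forall t, 0 < t ->
    (wasserstein2 (distribution P (X t)) mu <= (C * expR (- (r * t)))%:E)%E) ->
  cutoff_stability X mu (fun eps => r^-1 * `|ln eps|).
Proof.
move=> r0 c0 C0 lo up.
(* The bound [- 0] is the form in which [near_ln_le] delivers eps < 1; it makes |ln eps| = - ln eps
   positive. *)
have pos delta eps : 0 < delta -> ln eps < - 0 -> 0 < delta * (r^-1 * `|ln eps|).
  rewrite oppr0 => d0 l0.
  by rewrite mulr_gt0// mulr_gt0 ?invr_gt0// normr_gt0 lt_eqF.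
have scaled a delta eps : 0 < eps -> ln eps < - 0 ->
    a * expR (- (r * (delta * (r^-1 * `|ln eps|)))) * eps^-1 =
    a * expR ((delta - 1) * ln eps).
  rewrite oppr0 => e0 l0; rewrite ltr0_norm// -mulrA; congr (_ * _).
  rewrite -{2}(lnK e0) -expRN -expRD; congr expR.
  by field; rewrite gt_eqF.
split=> delta.
  move=> /andP[d0 d1]; apply/cvgeyPge => M.
  near=> eps.
  have e0 : 0 < eps by near: eps; exact: nbhs_right_gt.
  have l0 : ln eps < - 0 by near: eps; exact: near_ln_le.
  (* Chosen so that exp y >= 1 + y makes c eps^(delta - 1) exceed M. *)
  have lM : ln eps < - (`|M| / (c * (1 - delta))) by near: eps; exact: near_ln_le.
  apply: (@le_trans _ _ ((c * expR (- (r * (delta * (r^-1 * `|ln eps|)))))%:E * (eps^-1)%:E)%E).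
    rewrite -EFinM lee_fin scaled//.
    have cd : 0 < c * (1 - delta) by rewrite mulr_gt0// subr_gt0.
    have : `|M| < - ln eps * (c * (1 - delta)) by rewrite -ltr_pdivrMr//; lra.
    have := expR_ge1Dx ((delta - 1) * ln eps); rewrite -(ler_pM2l c0).
    by have := ler_norm M; nra.
  by rewrite lee_wpmul2r ?lee_fin ?invr_ge0 ?(ltW e0)//; apply: lo; exact: pos.
move=> d1; have d0 : 0 < delta by exact: lt_trans d1.
apply: (@squeeze_cvge _ _ _ _ (fun=> 0%E) _ (fun eps => (C * expR ((delta - 1) * ln eps))%:E)).
- near=> eps.
  have e0 : 0 < eps by near: eps; exact: nbhs_right_gt.
  have l0 : ln eps < - 0 by near: eps; exact: near_ln_le.
  apply/andP; split.
    by rewrite mule_ge0 ?lee_fin ?invr_ge0 ?(ltW e0)// sqrte_ge0.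
  rewrite -scaled// EFinM lee_wpmul2r ?lee_fin ?invr_ge0 ?(ltW e0)//.
  by apply: up; exact: pos.
- exact: cvg_cst.
apply: cvg_EFin; first exact: nearW.
apply/cvgrPdist_le => e e0; near=> eps.
have l0 : ln eps < - 0 by near: eps; exact: near_ln_le.
(* The same inequality for the reciprocal exponential makes C eps^(delta - 1) at most e. *)
have lM : ln eps < - (C / (e * (delta - 1))) by near: eps; exact: near_ln_le.
rewrite sub0r normrN ger0_norm ?mulr_ge0 ?expR_ge0//.
have ed : 0 < e * (delta - 1) by rewrite mulr_gt0// subr_gt0.
have h : C < - ln eps * (e * (delta - 1)) by rewrite -ltr_pdivrMr//; lra.
rewrite /= -[_ * ln eps]opprK expRN ler_pdivrMr ?expR_gt0//.
have := expR_ge1Dx (- ((delta - 1) * ln eps)); rewrite -(ler_pM2l e0).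
by nra.
Unshelve. all: by end_near. Qed.

Theorem corollary3p1 (R : realType) (m n : nat)
    (A : 'M[R]_m.+1) (hA : A *m A^T = A^T *m A)
    (phi : 'I_m.+1 -> R) (v : 'I_m.+1 -> 'cV[R]_m.+1)
    (hphi0 : 0 < phi ord0)
    (hphi : forall i j : 'I_m.+1, (i <= j)%N -> phi i <= phi j)
    (hv : orthonormal_family v)
    (heig : forall j, (A + A^T) *m v j = phi j *: v j)
    (lambda : 'I_m.+1 -> R[i]) (hlambda : eigenvalues_of A lambda)
    (hRe : forall i j : 'I_m.+1, (i <= j)%N ->
       complex.Re (lambda i) <= complex.Re (lambda j))
    (sigma : 'M[R]_(m.+1, n)) (hsigma : sigma *m sigma^T = 1%:M)
    (d : measure_display) (Omega : measurableType d) (P : probability Omega R)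
    (L : R -> {RV P >-> 'cV[R]_n}) (hL : standard_brownian_motion L)
    (x : 'cV[R]_m.+1)
    (X : R -> {RV P >-> 'cV[R]_m.+1}) (hX : sde_solution A sigma L x X)
    (mu : probability 'cV[R]_m.+1 R)
    (hmu : gaussian_law 0 (Sigma_infty A) mu) :
  [/\ (x != 0 -> inner x (v ord0) != 0 ->
         cutoff_stability X mu
           (fun eps => (complex.Re (lambda ord0))^-1 * `|ln eps|)),
      (forall rho : R, x != 0 -> inner x (v ord0) = 0 ->
         let D := [set complex.Re (lambda j) | j in
                     [set j | inner x (v j) != 0]] in
         D rho -> lbound D rho ->
         rho < 2 * complex.Re (lambda ord0) ->
         cutoff_stability X mu (fun eps => rho^-1 * `|ln eps|)) &
      (x = 0 ->
         cutoff_stability X mu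
           (fun eps => (2 * complex.Re (lambda ord0))^-1 * `|ln eps|))].
Proof.
have phiE := eigenvalue_real_part hA hphi hv heig hlambda hRe.
have phi0_le j : phi ord0 <= phi j by exact: hphi.
have phi_gt0 j : 0 < phi j by exact: lt_le_trans hphi0 (phi0_le j).
have cf := charfun_stationary hA hv heig phi_gt0 hmu.
have law t (t0 : 0 < t) := law_solution hA hv heig phi_gt0 hsigma hL hX hmu t0.
have sqnormE t := sqnorm_expmx hA hv heig t x.
pose M := \int[mu]_y sqnorm y.
have M0 : 0 <= M by apply: Rintegral_ge0 => y _; exact: sqnorm_ge0.
have expR_sqr s : expR s ^+ 2 = expR (2 * s).
  by rewrite expr2 -expRD; congr expR; ring.
(* From 2 |a|^2 + 2 e^{-2 phi_1 t} M by bounding both exponential factors by e^{-2rt}; the constant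
   does not depend on r. *)
pose C := Num.sqrt (2 * sqnorm x + 2 * M).
have C2 : C ^+ 2 = 2 * sqnorm x + 2 * M.
  by rewrite sqr_sqrtr// addr_ge0// mulr_ge0// sqnorm_ge0.
(* The first condition on r lets the covariance term decay at least as fast as e^{-rt}, the second
   does so for each mode of the mean present in x. *)
have up r : r <= phi ord0 -> (forall l, inner x (v l) != 0 -> 2 * r <= phi l) ->
    forall t, 0 < t ->
    (wasserstein2 (distribution P (X t)) mu <= (C * expR (- (r * t)))%:E)%E.
  move=> r0 hr t t0.
  apply: (wasserstein2_le hv phi_gt0 cf (ltW t0) (law t t0) phi0_le).
    by rewrite mulr_ge0 ?sqrtr_ge0 ?expR_ge0.
  rewrite exprMn C2 [leRHS]mulrDl; apply: lerD.
    rewrite -mulrA ler_wpM2l// sqnormE (sqnorm_sum hv) mulr_suml; apply: ler_sum => l _.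
    have [e|ne] := eqVneq (inner x (v l)) 0.
      by rewrite innerC e expr0n /= mulr0 mul0r.
    rewrite mulrC ler_wpM2l ?sqr_ge0// expR_sqr ler_expR.
    by have := hr l ne; nra.
  rewrite -[leRHS]mulrA ler_wpM2l// [leRHS]mulrC ler_wpM2r//.
  by rewrite ler_sqr ?nnegrE ?expR_ge0// ler_expR lerN2 ler_wpM2r// ltW.
(* A single mode of |a|^2 is kept, with the rate phi_j / 2 = Re(lambda_j). *)
have lo j t : 0 < t ->
    ((`|inner x (v j)| * expR (- (phi j / 2 * t)))%:E <=
     wasserstein2 (distribution P (X t)) mu)%E.
  move=> t0.
  apply: (wasserstein2_ge_mean cf (law t t0)).
    by rewrite mulr_ge0 ?expR_ge0.
  rewrite exprMn real_normK ?num_real// sqnormE (bigD1 j)//= expR_sqr innerC mulrC.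
  rewrite (_ : 2 * _ = - (phi j * t)); last by field.
  by rewrite lerDl; apply: sumr_ge0 => l _; rewrite mulr_ge0 ?expR_ge0 ?sqr_ge0.
have C0 : 0 <= C by exact: sqrtr_ge0.
split.
- move=> _ x0; have re : complex.Re (lambda ord0) = phi ord0 / 2 by rewrite phiE; field.
  rewrite re; apply: (exponential_cutoff (c := `|inner x (v ord0)|) (C := C)) => //.
  - by rewrite divr_gt0.
  - by rewrite normr_gt0.
  - by apply: lo.
  apply: up; first lra.
  by move=> l _; have := phi0_le l; lra.
- move=> rho _ _ D [j /= xj re] rho_min rho_lt.
  have rhoE : rho = phi j / 2 by rewrite phiE -re; field.
  have := phi_gt0 j => phij.
  apply: (exponential_cutoff (c := `|inner x (v j)|) (C := C)) => //.
  - lra.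
  - by rewrite normr_gt0.
  - by rewrite rhoE; apply: lo.
  (* The assumption rho < 2 Re(lambda_1) = phi_1 keeps the covariance below the mean; minimality of
     rho handles the other modes of x. *)
  apply: up; first by rewrite phiE ltW.
  by move=> l xl; rewrite phiE ler_pM2l//; apply: rho_min; exists l.
move=> x0; rewrite -phiE.
pose q := \int[mu]_y (inner (v ord0) y ^+ 2).
have q0 : 0 < q.
  apply: (second_moment_gt0 _ cf).
    by move=> s u; rewrite mulr_sumr; apply: eq_bigr => l _; rewrite innerZr; ring.
  (* The variance in direction [v ord0] contains the positive term 1 / phi_1. *)
  rewrite (bigD1 ord0)//= hv eqxx expr1n mulr1 ltr_wpDr ?invr_gt0//.
  by apply: sumr_ge0 => l _; rewrite mulr_ge0 ?sqr_ge0 ?invr_ge0 ?ltW.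
apply: (exponential_cutoff (c := Num.sqrt q / 2) (C := C)) => //.
- by rewrite divr_gt0 ?sqrtr_gt0.
- move=> t t0; rewrite mulrC mulrCA mulrC mulrAC -mulrA.
  rewrite (_ : expR _ * _ = expR (- (phi ord0 * t)) / 2 * Num.sqrt q); last by ring.
  apply: (wasserstein2_ge_spread hv phi_gt0 cf (ltW t0) (law t t0)) => //.
  - by rewrite x0 mulmx0.
  - by rewrite sqr_sqrtr// ltW.
(* No mode is present in x = 0, so the condition on the mean is vacuous and the full rate phi_1 is
   admissible. *)
by apply: up => // l; rewrite x0 inner0l eqxx.
Qed.
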